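(* Let $\hat{\boldsymbol{\Sigma}} = (\hat\sigma_{ij})$ be an affine equivariant statistic with values in the $p \times p$ complex Hermitian matrices, with finite second-order moments, and based on a random sample $\mathbf{x}_1,\ldots,\mathbf{x}_n \in \mathbb{C}^p$ (i.i.d.) from a complex elliptically symmetric (CES) distribution $\mathbb{C}\mathcal{E}_p(\boldsymbol{\mu}, \boldsymbol{\Sigma}, g)$. Then $\mathbb{E}[\hat{\boldsymbol{\Sigma}}] = \sigma \boldsymbol{\Sigma}$ with $\sigma = \mathbb{E}_{\mathbf{0},\mathbf{I}}[\hat\sigma_{11}]$, and $$\mathrm{var}(\hat{\boldsymbol{\Sigma}}) = \tau_1 (\boldsymbol{\Sigma}^* \otimes \boldsymbol{\Sigma}) + \tau_2\, \mathrm{vec}(\boldsymbol{\Sigma})\mathrm{vec}(\boldsymbol{\Sigma})^{\mathsf{H}},$$ $$\mathrm{pvar}(\hat{\boldsymbol{\Sigma}}) = \tau_1 (\boldsymbol{\Sigma}^* \otimes \boldsymbol{\Sigma})\mathbf{K}_{p,p} + \tau_2\, \mathrm{vec}(\boldsymbol{\Sigma})\mathrm{vec}(\boldsymbol{\Sigma})^{\top},$$ where $\tau_1 = \mathrm{var}_{\mathbf{0},\mathbf{I}}(\hat\sigma_{12})$ and $\tau_2 = \mathrm{cov}_{\mathbf{0},\mathbf{I}}(\hat\sigma_{11}, \hat\sigma_{22}) \geq -\tau_1/p$.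
   Context: Notation: $(\cdot)^*$, $(\cdot)^\top$, $(\cdot)^{\mathsf{H}}$ denote the complex conjugate, the transpose and the conjugate transpose. $\mathbf{I}$ is the identity matrix, $\mathbf{1}$ the vector of ones, $\mathbf{e}_i$ the $i$th standard basis vector. For a matrix $\mathbf{A} = (\mathbf{a}_1 \cdots \mathbf{a}_p)$ with columns $\mathbf{a}_i$, $\mathrm{vec}(\mathbf{A}) = (\mathbf{a}_1^\top \cdots \mathbf{a}_p^\top)^\top$. $\otimes$ is the Kronecker product, and $\mathbf{K}_{p,p} = \sum_{i,j=1}^p \mathbf{e}_i\mathbf{e}_j^\top \otimes \mathbf{e}_j\mathbf{e}_i^\top$ is the $p^2\times p^2$ commutation matrix. For complex random vectors (or scalars) $\mathbf{x}_1,\mathbf{x}_2$ with finite second-order moments, $\mathrm{cov}(\mathbf{x}_1,\mathbf{x}_2) = \mathbb{E}[(\mathbf{x}_1-\mathbb{E}[\mathbf{x}_1])(\mathbf{x}_2-\mathbb{E}[\mathbf{x}_2])^{\mathsf{H}}]$ and $\mathrm{pcov}(\mathbf{x}_1,\mathbf{x}_2) = \mathbb{E}[(\mathbf{x}_1-\mathbb{E}[\mathbf{x}_1])(\mathbf{x}_2-\mathbb{E}[\mathbf{x}_2])^{\top}]$; moreover $\mathrm{var}(\mathbf{x}) = \mathrm{cov}(\mathbf{x},\mathbf{x})$ and $\mathrm{pvar}(\mathbf{x}) = \mathrm{pcov}(\mathbf{x},\mathbf{x})$. For a random matrix $\mathbf{A}$, $\mathrm{var}(\mathbf{A}) = \mathrm{var}(\mathrm{vec}(\mathbf{A}))$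 and $\mathrm{pvar}(\mathbf{A}) = \mathrm{pvar}(\mathrm{vec}(\mathbf{A}))$. CES distributions: a random vector $\mathbf{x}\in\mathbb{C}^p$ has a (circular) CES distribution if and only if it has the same distribution as $\boldsymbol{\mu} + r\,\boldsymbol{\Sigma}^{1/2}\mathbf{u}$, where $\boldsymbol{\mu} = \mathbb{E}[\mathbf{x}]$, $\boldsymbol{\Sigma}$ is a Hermitian positive definite $p\times p$ matrix with unique Hermitian positive definite square root $\boldsymbol{\Sigma}^{1/2}$, $\mathbf{u}$ is uniformly distributed on the complex unit sphere $\{\mathbf{u}\in\mathbb{C}^p : \|\mathbf{u}\| = 1\}$, and $r>0$ is a positive random variable (the modular variate) independent of $\mathbf{u}$. One writes $\mathbf{x}\sim\mathbb{C}\mathcal{E}_p(\boldsymbol{\mu},\boldsymbol{\Sigma},g)$ when the distribution is absolutely continuous, with density equal, up to a constant, to $|\boldsymbol{\Sigma}|^{-1} g\big((\mathbf{x}-\boldsymbol{\mu})^{\mathsf{H}}\boldsymbol{\Sigma}^{-1}(\mathbf{x}-\boldsymbol{\mu})\big)$, where $g:\mathbb{R}_{\geq 0}\to\mathbb{R}_{>0}$ is the density generator. Standing assumption: $\mathbf{x}$ has finite fourth-order moments, and the normalization is such that $\boldsymbol{\Sigma} = \mathrm{var}(\mathbf{x})$ (so that $\mathbb{E}[r^2] = p$). Affine equivariance: a statistic $\hat{\boldsymbol{\Sigma}} = \hat{\boldsymbol{\Sigma}}(\mathbf{X})$, a Hermitian-$p\times p$-matrix-valued function of the $n\times p$ data matrix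 $\mathbf{X} = (\mathbf{x}_1 \cdots \mathbf{x}_n)^\top$ of $n\geq 1$ observations on $p$ complex-valued variables, is affine equivariant if $\hat{\boldsymbol{\Sigma}}(\mathbf{X}\mathbf{A}^\top + \mathbf{1}\mathbf{a}^\top) = \mathbf{A}\,\hat{\boldsymbol{\Sigma}}(\mathbf{X})\,\mathbf{A}^{\mathsf{H}}$ for all $\mathbf{A}\in\mathbb{C}^{p\times p}$ and $\mathbf{a}\in\mathbb{C}^p$. The subscript $\mathbf{0},\mathbf{I}$ in $\mathbb{E}_{\mathbf{0},\mathbf{I}}$, $\mathrm{var}_{\mathbf{0},\mathbf{I}}$, $\mathrm{cov}_{\mathbf{0},\mathbf{I}}$ means that the quantity is computed when $\hat{\boldsymbol{\Sigma}}$ is based on an i.i.d. sample of size $n$ from the spherical distribution $\mathbb{C}\mathcal{E}_p(\mathbf{0},\mathbf{I},g)$ with the same density generator $g$; unsubscripted quantities are computed under $\mathbb{C}\mathcal{E}_p(\boldsymbol{\mu},\boldsymbol{\Sigma},g)$. *)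

(* Defs.v *)
From HB Require Import structures.
From mathcomp Require Import all_boot all_order all_algebra.
From mathcomp Require Import complex mxtens spectral.
From mathcomp Require Import all_classical all_reals all_analysis.

Set Implicit Arguments.
Unset Strict Implicit.
Unset Printing Implicit Defensive.

Import Order.TTheory GRing.Theory Num.Theory.
Import numFieldNormedType.Exports.

Local Open Scope classical_set_scope.
Local Open Scope sesquilinear_scope.
Local Open Scope ring_scope.

(* Neither [R[i]] nor matrices carry a sigma-algebra in the library. Both get
   the one generated by their coordinates, which is the Borel one. *)
Definition complex_display : measure_display.
Proof. exact: default_measure_display. Qed.

Section complex_measurable.
Context (R : realType).

HB.instance Definition _ := isPointed.Build R[i] 0.

Let borelC : set (set R[i]) :=
  g_sigma_preimageU (@complex.Re R) (@complex.Im R).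

Let borelC0 : borelC set0. Proof. exact: (@sigma_algebra0 _ setT). Qed.

Let borelCC A : borelC A -> borelC (~` A). Proof. exact: (@sigma_algebraC _ _ A). Qed.

Let borelC_bigcup (F : (set R[i])^nat) :
  (forall k, borelC (F k)) -> borelC (\bigcup_k F k).
Proof. exact: (@sigma_algebra_bigcup _ setT _ F). Qed.

HB.instance Definition _ := @isMeasurable.Build complex_display R[i]
  borelC borelC0 borelCC borelC_bigcup.

Lemma measurable_Re : measurable_fun [set: R[i]] (@complex.Re R).
Proof. by move=> _ A mA; apply: sub_sigma_algebra; left; exists A. Qed.

Lemma measurable_Im : measurable_fun [set: R[i]] (@complex.Im R).
Proof. by move=> _ A mA; apply: sub_sigma_algebra; right; exists A. Qed.

Lemma measurable_Complex :
  measurable_fun [set: measurableTypeR R * measurableTypeR R] (fun z => (z.1 +i* z.2)%C : R[i]).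
Proof.
apply: (measurability (preimage_set_system setT (@complex.Re R) measurable
  `|` preimage_set_system setT (@complex.Im R) measurable)) => //.
move=> _ [_ [] [A mA <-] <-]; rewrite !setTI.
- by have := @measurable_fst _ _ (measurableTypeR R) (measurableTypeR R) measurableT A mA; rewrite setTI.
- by have := @measurable_snd _ _ (measurableTypeR R) (measurableTypeR R) measurableT A mA; rewrite setTI.
Qed.

End complex_measurable.

Definition matrix_display : measure_display -> measure_display.
Proof. exact. Qed.

Section matrix_measurable.
Context {d} {T : measurableType d} (m n : nat).

Let borelM : set (set 'M[T]_(m, n)) :=
  <<s \bigcup_(k in [set: 'I_m * 'I_n])
        preimage_set_system setT (fun M : 'M[T]_(m, n) => M k.1 k.2)
          measurable >>.

Let borelM0 : borelM set0. Proof. exact: (@sigma_algebra0 _ setT). Qed.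

Let borelMC A : borelM A -> borelM (~` A). Proof. exact: (@sigma_algebraC _ _ A). Qed.

Let borelM_bigcup (F : (set 'M[T]_(m, n))^nat) :
  (forall k, borelM (F k)) -> borelM (\bigcup_k F k).
Proof. exact: (@sigma_algebra_bigcup _ setT _ F). Qed.

HB.instance Definition _ := @isMeasurable.Build (matrix_display d)
  'M[T]_(m, n) borelM borelM0 borelMC borelM_bigcup.

Lemma measurable_mxcoef i j :
  measurable_fun [set: 'M[T]_(m, n)] (fun M : 'M[T]_(m, n) => M i j).
Proof.
move=> _ A mA; apply: sub_sigma_algebra; exists (i, j) => //.
by exists A.
Qed.

Lemma measurable_fun_mxP d' (T' : measurableType d') (f : T' -> 'M[T]_(m, n)) :
  (forall i j, measurable_fun setT (fun x => f x i j)) ->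
  measurable_fun setT f.
Proof.
move=> mf; apply: (measurability (\bigcup_(k in [set: 'I_m * 'I_n])
        preimage_set_system setT (fun M : 'M[T]_(m, n) => M k.1 k.2)
          measurable)) => //.
move=> _ [_ [[i j] _ [A mA <-]] <-].
rewrite setTI; exact: mf.
Qed.

End matrix_measurable.
Section lebesgue_measure_complex.
Context (R : realType).
Local Notation lambda := (@lebesgue_measure R).
Local Notation RR := (measurableTypeR R).

Definition cV_cons p (z : 'cV[R[i]]_p * RR * RR) : 'cV[R[i]]_p.+1 :=
  col_mx (z.1.2 +i* z.2)%C%:M z.1.1.

Lemma measurable_cV_cons p : measurable_fun setT (@cV_cons p).
Proof.
apply: measurable_fun_mxP => i j; rewrite /cV_cons.
under eq_fun do rewrite mxE.
case: (@fintype.split 1 p i) => k; last first.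
  exact: measurableT_comp (measurable_mxcoef k j)
    (measurableT_comp measurable_fst measurable_fst).
rewrite (ord1 k) (ord1 j); under eq_fun do rewrite mxE eqxx mulr1n.
apply: (measurableT_comp (@measurable_Complex R)
  (g := fun z : 'cV[R[i]]_p * RR * RR => (z.1.2, z.2))).
by apply: measurable_fun_pair => //; exact: measurableT_comp.
Qed.

Section step.
Context (p : nat) (m : {measure set 'cV[R[i]]_p -> \bar R}).

Definition lebesgueC_step : set 'cV[R[i]]_p.+1 -> \bar R :=
  pushforward ((m \x lambda) \x lambda)%E (@cV_cons p).

Let step0 : lebesgueC_step set0 = 0%E.
Proof. by rewrite /lebesgueC_step /pushforward preimage_set0 measure0. Qed.

Let step_ge0 A : (0 <= lebesgueC_step A)%E.
Proof.
rewrite /lebesgueC_step /pushforward.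
exact: (measure_ge0 ((m \x lambda) \x lambda)%E).
Qed.

Let step_sigma_additive : semi_sigma_additive lebesgueC_step.
Proof.
move=> F mF tF mUF; rewrite /lebesgueC_step /pushforward preimage_bigcup.
apply: measure_semi_sigma_additive.
- by move=> k; rewrite -[X in measurable X]setTI; exact: measurable_cV_cons.
- apply/trivIsetP => /= i j _ _ ij; rewrite -preimage_setI.
  by move/trivIsetP : tF => /(_ _ _ _ _ ij) ->//; rewrite preimage_set0.
- rewrite -preimage_bigcup -[X in measurable X]setTI.
  exact: measurable_cV_cons.
Qed.

HB.instance Definition _ := isMeasure.Build _ _ _ lebesgueC_step
  step0 step_ge0 step_sigma_additive.

End step.

(* Lebesgue measure on C^p identified with R^(2p), one complex coordinate
   (two real ones) at a time. *)
Fixpoint lebesgueC p : {measure set 'cV[R[i]]_p -> \bar R} :=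
  match p with
  | 0 => dirac (0 : 'cV[R[i]]_0)
  | p'.+1 => lebesgueC_step (lebesgueC p')
  end.

End lebesgue_measure_complex.

Section random_variables.
Context {R : realType} {d} {T : measurableType d} (P : probability T R).

Definition finite_moment (k : nat) (X : T -> R[i]) : Prop :=
  P.-integrable setT (fun w => (Normc.normc (X w) ^+ k)%:E).

Definition cexp (X : T -> R[i]) : R[i] :=
  (fine 'E_P[fun w => complex.Re (X w)] +i* fine 'E_P[fun w => complex.Im (X w)])%C.

Definition ccov (X Y : T -> R[i]) : R[i] :=
  cexp (fun w => (X w - cexp X) * Num.conj (Y w - cexp Y)).

Definition cvar (X : T -> R[i]) : R[i] := ccov X X.

Definition mxexp m k (X : T -> 'M[R[i]]_(m, k)) : 'M[R[i]]_(m, k) :=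
  \matrix_(i, j) cexp (fun w => X w i j).

Definition cov m k (X : T -> 'cV[R[i]]_m) (Y : T -> 'cV[R[i]]_k)
    : 'M[R[i]]_(m, k) :=
  mxexp (fun w => (X w - mxexp X) *m (Y w - mxexp Y)^t*).

Definition pcov m k (X : T -> 'cV[R[i]]_m) (Y : T -> 'cV[R[i]]_k)
    : 'M[R[i]]_(m, k) :=
  mxexp (fun w => (X w - mxexp X) *m (Y w - mxexp Y)^T).

Definition var m (X : T -> 'cV[R[i]]_m) : 'M[R[i]]_m := cov X X.

Definition pvar m (X : T -> 'cV[R[i]]_m) : 'M[R[i]]_m := pcov X X.

Definition independent2 d1 d2 (T1 : measurableType d1) (T2 : measurableType d2)
    (X : T -> T1) (Y : T -> T2) : Prop :=
  forall A B, measurable A -> measurable B ->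
    P (X @^-1` A `&` Y @^-1` B) = (P (X @^-1` A) * P (Y @^-1` B))%E.

Definition mutually_independent d1 (T1 : measurableType d1) n
    (X : 'I_n -> T -> T1) : Prop :=
  forall (J : {set 'I_n}) (B : 'I_n -> set T1), (forall i, measurable (B i)) ->
    P (\bigcap_(i in [set` J]) X i @^-1` B i) =
    (\prod_(i in J) P (X i @^-1` B i))%E.

End random_variables.

Section matrices.
Context {R : realType}.

(* Column stacking: entry j * m + i of [vec A] is [A i j], the indexing of
   the Kronecker product [*t]. *)
Definition vec m n (A : 'M[R[i]]_(m, n)) : 'cV[R[i]]_(n * m) :=
  \col_k A (mxtens_unindex k).2 (mxtens_unindex k).1.

Definition commutation_mx p : 'M[R[i]]_(p * p) :=
  \sum_(i < p) \sum_(j < p) (delta_mx i j *t delta_mx j i).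

(* The order of [R[i]] is partial: [0 < z] means that [z] is real and
   positive. *)
Definition posdefmx p (A : 'M[R[i]]_p) : Prop :=
  A \is hermsymmx /\
  forall v : 'cV[R[i]]_p, v != 0 -> 0 < (v^t* *m A *m v) 0 0.

Definition vnorm p (v : 'cV[R[i]]_p) : R :=
  Num.sqrt (complex.Re ((v^t* *m v) 0 0)).

End matrices.

Section elliptical_distributions.
Context {R : realType} (p : nat).

(* The uniform law on the unit sphere is the law of [z / |z|] for [z] uniform
   on the unit ball, i.e. the normalized surface measure. *)
Definition uniform_on_sphere d (T : measurableType d) (P : probability T R)
    (u : T -> 'cV[R[i]]_p) : Prop :=
  (forall w, vnorm (u w) = 1) /\
  forall B : set 'cV[R[i]]_p, measurable B ->
    let ball := [set z | vnorm z <= 1] in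
    let cone := [set z | vnorm z <= 1 /\ B ((vnorm z)^-1%:C%C *: z)] in
    (P (u @^-1` B) * lebesgueC R p ball = lebesgueC R p cone)%E.

Definition ces_representation d (T : measurableType d) (P : probability T R)
    (x : T -> 'cV[R[i]]_p) (mu : 'cV[R[i]]_p) (Sigma : 'M[R[i]]_p) : Prop :=
  exists2 S : 'M[R[i]]_p, posdefmx S /\ S *m S = Sigma &
  exists (d' : measure_display) (T' : measurableType d')
    (P' : probability T' R) (r : {RV P' >-> R}) (u : {RV P' >-> 'cV[R[i]]_p}),
    [/\ forall w, 0 < r w,
        uniform_on_sphere P' u,
        independent2 P' r u &
        forall B : set 'cV[R[i]]_p, measurable B ->
          P (x @^-1` B) =
          P' ((fun w => mu + (r w)%:C%C *: (S *m u w)) @^-1` B)].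

Definition density_generator (g : R -> R) : Prop :=
  measurable_fun (`[0, +oo[ : set R) g /\ forall t, 0 <= t -> 0 < g t.

(* For a complex law the factor is [|Sigma|^-1], not [|Sigma|^(-1/2)]; the
   determinant and the quadratic form are real, hence the projections [Re].
   The normalizing constant is left out. *)
Definition ces_density (mu : 'cV[R[i]]_p) (Sigma : 'M[R[i]]_p) (g : R -> R)
    (z : 'cV[R[i]]_p) : R :=
  (complex.Re (\det Sigma))^-1 *
  g (complex.Re (((z - mu)^t* *m invmx Sigma *m (z - mu)) 0 0)).

(* The field [ces_var] fixes the scale of the pair (Sigma, g), which is
   otherwise determined only up to a positive factor. *)
Record ces d (T : measurableType d) (P : probability T R)
    (x : T -> 'cV[R[i]]_p) (mu : 'cV[R[i]]_p) (Sigma : 'M[R[i]]_p)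
    (g : R -> R) : Prop := {
  ces_posdef : posdefmx Sigma ;
  ces_moment4 : forall i, finite_moment P 4 (fun w => x w i 0) ;
  ces_mean : mxexp P x = mu ;
  ces_var : var P x = Sigma ;
  ces_repr : ces_representation P x mu Sigma ;
  ces_abs_continuous : exists2 c : R, 0 < c &
    forall B : set 'cV[R[i]]_p, measurable B ->
      P (x @^-1` B) =
      (\int[lebesgueC R p]_(z in B) (c * ces_density mu Sigma g z)%:E)%E
}.

Definition ces_sample d (T : measurableType d) (P : probability T R) n
    (x : 'I_n -> {RV P >-> 'cV[R[i]]_p}) (mu : 'cV[R[i]]_p)
    (Sigma : 'M[R[i]]_p) (g : R -> R) : Prop :=
  mutually_independent P (fun i => x i : T -> 'cV[R[i]]_p) /\
  forall i, ces P (x i) mu Sigma g.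

Definition data_mx (T : Type) n (x : 'I_n -> T -> 'cV[R[i]]_p) (w : T)
    : 'M[R[i]]_(n, p) :=
  \matrix_(i, j) x i w j 0.

Definition affine_equivariant n (Shat : 'M[R[i]]_(n, p) -> 'M[R[i]]_p)
    : Prop :=
  forall (X : 'M[R[i]]_(n, p)) (A : 'M[R[i]]_p) (a : 'cV[R[i]]_p),
    Shat (X *m A^T + const_mx 1 *m a^T) = A *m Shat X *m A^t*.

End elliptical_distributions.

(* Main.v *)
(** A positive multiple of [g (|z|^2)] is the density of the standardised law,
   and a translation-invariant sigma-finite measure on C^p is a multiple of
   Lebesgue measure (by Fubini). Hence, for every invertible [B] with
   [B B^H = Sigma], the law of [B x0 + mu] has a density proportional to, so
   equal to, the density of the law of [x]. By independence the data matrices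
   agree in law too, and by equivariance the law of the statistic is that of
   [B S0 B^H]. For [Sigma = 1] this says that the law of [S0] is invariant under
   unitary conjugation; this reduces everything to the second-order tensor
   [T_ij,kl = cov (S0_ij, S0_kl)]. Invariance under diagonal phases leaves only
   the entries [T_ii,kk] and [T_ij,ij], permutations make them constant, and one
   Householder reflection gives [T_ii,ii = T_ij,ij + T_ii,kk]. The inequality is
   the nonnegativity of the variance of the trace of [S0],
   [p tau1 + p^2 tau2]. *)
From HB Require Import structures.
Require Import Defs.
From mathcomp Require Import all_boot all_order all_algebra.
From mathcomp Require Import fingroup perm complex mxtens spectral.
From mathcomp Require Import all_classical all_reals all_analysis.
From mathcomp Require Import measurable_realfun.
From mathcomp Require Import ring lra.

Set Implicit Arguments.
Unset Strict Implicit.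
Unset Printing Implicit Defensive.

Import Order.TTheory GRing.Theory Num.Theory.
Import numFieldNormedType.Exports.

Local Open Scope classical_set_scope.
Local Open Scope sesquilinear_scope.
Local Open Scope ring_scope.

(** * Measurability of complex vectors and matrices *)

Section complex_measurability.
Context {R : realType} d (T : measurableType d).
Implicit Types f g : T -> R[i].

Lemma measurable_complexP f :
  measurable_fun setT (fun w => complex.Re (f w)) ->
  measurable_fun setT (fun w => complex.Im (f w)) -> measurable_fun setT f.
Proof.
move=> mr mi; have -> : f = (fun z => (z.1 +i* z.2)%C) \o
    (fun w => (complex.Re (f w), complex.Im (f w))).
  by apply/funext => w /=; case: (f w).
by apply: (measurableT_comp (@measurable_Complex R)); exact: measurable_fun_pair.
Qed.

Lemma measurable_fun_Re f :
  measurable_fun setT f -> measurable_fun setT (fun w => complex.Re (f w)).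
Proof. by move=> mf; exact: (measurableT_comp (@measurable_Re R) mf). Qed.

Lemma measurable_fun_Im f :
  measurable_fun setT f -> measurable_fun setT (fun w => complex.Im (f w)).
Proof. by move=> mf; exact: (measurableT_comp (@measurable_Im R) mf). Qed.

Lemma measurable_fun_cadd f g : measurable_fun setT f ->
  measurable_fun setT g -> measurable_fun setT (fun w => f w + g w).
Proof.
move=> mf mg; apply: measurable_complexP.
- under eq_fun do rewrite raddfD /=.
  by apply: measurable_funD; exact: measurable_fun_Re.
- under eq_fun do rewrite raddfD /=.
  by apply: measurable_funD; exact: measurable_fun_Im.
Qed.

Lemma measurable_fun_cmul f g : measurable_fun setT f ->
  measurable_fun setT g -> measurable_fun setT (fun w => f w * g w).
Proof.
move=> mf mg; apply: measurable_complexP.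
- rewrite (_ : (fun _ => _) = (fun w =>
    complex.Re (f w) * complex.Re (g w) - complex.Im (f w) * complex.Im (g w))).
    apply: measurable_funB; apply: measurable_funM;
      by [exact: measurable_fun_Re|exact: measurable_fun_Im].
  by apply/funext => w; case: (f w); case: (g w).
- rewrite (_ : (fun _ => _) = (fun w =>
    complex.Re (f w) * complex.Im (g w) + complex.Im (f w) * complex.Re (g w))).
    apply: measurable_funD; apply: measurable_funM;
      by [exact: measurable_fun_Re|exact: measurable_fun_Im].
  by apply/funext => w; case: (f w); case: (g w).
Qed.

Lemma measurable_fun_conj f :
  measurable_fun setT f -> measurable_fun setT (fun w => Num.conj (f w)).
Proof.
move=> mf; apply: measurable_complexP.
- rewrite (_ : (fun _ => _) = (fun w => complex.Re (f w))).
    exact: measurable_fun_Re.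
  by apply/funext => w; case: (f w).
- rewrite (_ : (fun _ => _) = (fun w => - complex.Im (f w))).
    by apply: measurable_funN; exact: measurable_fun_Im.
  by apply/funext => w; case: (f w).
Qed.

Lemma measurable_fun_csum (I : Type) (s : seq I) (P : pred I)
    (h : I -> T -> R[i]) : (forall i, measurable_fun setT (h i)) ->
  measurable_fun setT (fun w => \sum_(i <- s | P i) h i w).
Proof.
move=> mh; elim: s => [|i s IH].
  by under eq_fun do rewrite big_nil; exact: measurable_cst.
under eq_fun do rewrite big_cons.
by case: (P i) => //; exact: measurable_fun_cadd.
Qed.

Lemma measurable_fun_mxcoef m n (X : T -> 'M[R[i]]_(m, n)) i j :
  measurable_fun setT X -> measurable_fun setT (fun w => X w i j).
Proof. by move=> mX; exact: (measurableT_comp (measurable_mxcoef i j) mX). Qed.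

Lemma measurable_fun_addmx m n (X Y : T -> 'M[R[i]]_(m, n)) :
  measurable_fun setT X -> measurable_fun setT Y ->
  measurable_fun setT (fun w => X w + Y w).
Proof.
move=> mX mY; apply: measurable_fun_mxP => i j.
under eq_fun do rewrite mxE.
by apply: measurable_fun_cadd; exact: measurable_fun_mxcoef.
Qed.

Lemma measurable_fun_mulmx m n k (X : T -> 'M[R[i]]_(m, n))
    (Y : T -> 'M[R[i]]_(n, k)) :
  measurable_fun setT X -> measurable_fun setT Y ->
  measurable_fun setT (fun w => X w *m Y w).
Proof.
move=> mX mY; apply: measurable_fun_mxP => i j.
under eq_fun do rewrite mxE.
apply: measurable_fun_csum => l.
by apply: measurable_fun_cmul; exact: measurable_fun_mxcoef.
Qed.

Lemma measurable_fun_oppmx m n (X : T -> 'M[R[i]]_(m, n)) :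
  measurable_fun setT X -> measurable_fun setT (fun w => - X w)%R.
Proof.
move=> mX; have -> : (fun w => - X w)%R = (fun w => (- 1%:M) *m X w)%R.
  by apply/funext => z; rewrite mulNmx mul1mx.
by apply: measurable_fun_mulmx => //; exact: measurable_cst.
Qed.

Lemma measurable_fun_adjmx m n (X : T -> 'M[R[i]]_(m, n)) :
  measurable_fun setT X -> measurable_fun setT (fun w => (X w)^t*).
Proof.
move=> mX; apply: measurable_fun_mxP => i j.
under eq_fun do rewrite !mxE.
by apply: measurable_fun_conj; exact: measurable_fun_mxcoef.
Qed.

End complex_measurability.

(** * Lebesgue measure on C^p *)

Section image_measure.
Local Open Scope ereal_scope.
Context {R : realType} d1 d2 (X : measurableType d1) (Y : measurableType d2).

Lemma measurable_preimage (f : X -> Y) (A : set Y) :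
  measurable_fun setT f -> measurable A -> measurable (f @^-1` A).
Proof. by move=> mf mA; rewrite -[_ @^-1` _]setTI; exact: mf. Qed.

Variables (m : {measure set X -> \bar R}) (m' : {measure set Y -> \bar R}).

(** Kept transparent, so that its value at [A] computes to the [m]-measure of the preimage of
    [A]. *)
Definition pushforward_measure (f : X -> Y) (mf : measurable_fun setT f) :
  {measure set Y -> \bar R}.
Proof. by refine (pushforward m f). Defined.

(** Change of variables when the image of [m] is known only through its values on measurable sets:
    integrate against the pushforward, then exchange it for [m']. *)
Lemma ge0_integral_image (phi : X -> Y) (D : set Y) (f : Y -> \bar R) :
  measurable_fun setT phi ->
  (forall A, measurable A -> m (phi @^-1` A) = m' A) ->
  measurable D -> measurable_fun setT f -> (forall y, 0 <= f y) ->
  \int[m]_(x in phi @^-1` D) f (phi x) = \int[m']_(y in D) f y.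
Proof.
move=> mphi mE mD mf f0.
have /= <- := ge0_integral_pushforward mphi m (f := f) mD
  (measurable_funS measurableT (@subsetT _ _) mf) (fun y _ => f0 y).
by apply: (eq_measure_integral m' (m1 := pushforward_measure mphi)) => A mA _;
  exact: mE.
Qed.

End image_measure.

Section sigma_finite_structure.
Local Open Scope ereal_scope.
Context {R : realType} d (X : measurableType d).
Variables (m : {measure set X -> \bar R}) (sf : sigma_finite setT m).

Let mu : set X -> \bar R := m.
HB.instance Definition _ := Measure.on mu.
HB.instance Definition _ := Measure_isSigmaFinite.Build _ _ _ mu sf.

(** Bundles a proof of sigma-finiteness, so that product measures and Fubini apply to measures
    obtained by recursion or as pushforwards. *)
Definition sigma_finite_pack : {sigma_finite_measure set X -> \bar R} := mu.

End sigma_finite_structure.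

(** * Measure-preserving maps and their products *)

Section measure_preserving.
Local Open Scope ereal_scope.
Context {R : realType}.

Definition preserves d (X : measurableType d) (m : set X -> \bar R)
    (f : X -> X) : Prop :=
  measurable_fun setT f /\ forall A, measurable A -> m (f @^-1` A) = m A.

(** The section at [x] of the preimage of [A] is the preimage under [g] of the section of [A] at
    [f x]; [g] preserves its measure, and [f] preserves the outer integral. *)
Lemma preserves_prod d1 d2 (X : measurableType d1) (Y : measurableType d2)
    (m1 : {measure set X -> \bar R}) (m2 : {sigma_finite_measure set Y -> \bar R})
    (f : X -> X) (g : Y -> Y) : preserves m1 f -> preserves m2 g ->
  preserves (m1 \x m2) (fun z => (f z.1, g z.2)).
Proof.
move=> [mf fE] [mg gE]; split.
  by apply: measurable_fun_pair => /=; exact: measurableT_comp.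
move=> A mA; rewrite /product_measure1.
transitivity (\int[m1]_x (m2 \o xsection A) (f x)).
  apply: eq_integral => x _ /=.
  by rewrite -(gE (xsection A (f x)))//; exact: measurable_xsection.
rewrite -[setT in LHS](@preimage_setT _ _ f); apply: ge0_integral_image => //.
exact: measurable_fun_xsection.
Qed.

End measure_preserving.

Section lebesgue_symmetries.
Local Open Scope ereal_scope.
Context {R : realType}.
Local Notation lambda := (@lebesgue_measure R).

(** Lebesgue measure is determined by its values on half-open intervals, whose lengths a shift
    keeps. *)
Lemma lebesgue_preserves_shift (a : R) :
  @preserves R _ (measurableTypeR R) lambda (fun x => x + a)%R.
Proof.
have ma : @measurable_fun _ _ (measurableTypeR R) (measurableTypeR R) setT
    (fun x => x + a)%R by exact: measurable_funD.
split=> // A mA.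
rewrite [RHS](@lebesgue_measure_unique R (pushforward_measure lambda ma))//.
move=> _ [[u v] _ <-] /=; rewrite /pushforward.
have -> : (fun x => x + a)%R @^-1` `]u, v]%classic = `](u - a)%R, (v - a)%R]%classic.
  by apply/seteqP; split=> x /=; rewrite !in_itv/= ltrBlDr lerBrDr.
rewrite !lebesgue_measure_itv/= !lte_fin ltrD2r -!EFinB.
by congr (if _ then _%:E else _); rewrite opprB addrA subrK.
Qed.

Lemma lebesgue_preserves_opp :
  @preserves R _ (measurableTypeR R) lambda (fun x => - x)%R.
Proof.
split; last by move=> A mA; exact: lebesgue_measureN.
exact: (@measurable_funN _ (measurableTypeR R)).
Qed.

(** Induction along the recursive definition of [lebesgueC]: a shift acts separately on the tail and
    on the two real coordinates of the head, so [preserves_prod] applies twice. *)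
Lemma lebesgueC_preserves_shift p (b : 'cV[R[i]]_p) :
  preserves (lebesgueC R p) (fun z : 'cV[R[i]]_p => z + b)%R.
Proof.
have mb q (c : 'cV[R[i]]_q) : measurable_fun setT (fun z : 'cV[R[i]]_q => z + c)%R.
  by apply: measurable_fun_addmx => //; exact: measurable_cst.
split; first exact: mb.
elim: p => [|p IH] in b *.
  by move=> A _; congr (_ _); apply/seteqP; split=> z;
    rewrite /preimage/= [z]flatmx0 [b]flatmx0 addr0.
move=> A mA; rewrite /= /lebesgueC_step /pushforward.
(* [b0] is the first coordinate of the shift and [b'] the remaining ones. *)
pose b0 : R[i] := usubmx (b : 'M[R[i]]_((1 + p)%N, 1)) 0%R 0%R.
pose b' : 'cV[R[i]]_p := dsubmx (b : 'M[R[i]]_((1 + p)%N, 1)).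
have : preserves ((lebesgueC R p \x lambda) \x lambda)
    (fun z => (z.1.1 + b', z.1.2 + complex.Re b0, z.2 + complex.Im b0)%R).
  apply: (preserves_prod (m1 := lebesgueC R p \x lambda) (m2 := lambda)
    (f := fun z => (z.1 + b', z.2 + complex.Re b0)%R)
    (g := (fun y : measurableTypeR R => y + complex.Im b0)%R)).
    apply: (preserves_prod (m1 := lebesgueC R p) (m2 := lambda)
      (f := (fun z : 'cV[R[i]]_p => z + b')%R)
      (g := (fun y : measurableTypeR R => y + complex.Re b0)%R)).
      by split; [exact: mb|exact: IH].
    exact: lebesgue_preserves_shift.
  exact: lebesgue_preserves_shift.
case=> _ fE; rewrite -[RHS]fE; last first.
  by apply: measurable_preimage => //; exact: measurable_cV_cons.
rewrite -comp_preimage; congr (_ _); congr (_ @^-1` A).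
apply/funext => -[[z x] y] /=; rewrite /cV_cons/=.
rewrite -[b in LHS](@vsubmxK _ 1 p 1) (add_col_mx (m1 := 1%N)).
rewrite [usubmx _]mx11_scalar -/b0 -raddfD /=.
by case: b0 {fE}.
Qed.

Lemma lebesgueC_preserves_opp p :
  preserves (lebesgueC R p) (fun z : 'cV[R[i]]_p => - z)%R.
Proof.
have mo q : measurable_fun setT (fun z : 'cV[R[i]]_q => - z)%R.
  exact: measurable_fun_oppmx.
split; first exact: mo.
elim: p => [|p IH].
  by move=> A _; congr (_ _); apply/seteqP; split=> z;
    rewrite /preimage/= [z]flatmx0 oppr0.
move=> A mA; rewrite /= /lebesgueC_step /pushforward.
have : preserves ((lebesgueC R p \x lambda) \x lambda)
    (fun z => (- z.1.1, - z.1.2, - z.2)%R).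
  apply: (preserves_prod (m1 := lebesgueC R p \x lambda) (m2 := lambda)
    (f := fun z => (- z.1, - z.2)%R) (g := (fun y : measurableTypeR R => - y)%R)).
    apply: (preserves_prod (m1 := lebesgueC R p) (m2 := lambda)
      (f := (fun z : 'cV[R[i]]_p => - z)%R)
      (g := (fun y : measurableTypeR R => - y)%R)).
      by split; first exact: mo.
    exact: lebesgue_preserves_opp.
  exact: lebesgue_preserves_opp.
case=> _ fE; rewrite -[RHS]fE; last first.
  by apply: measurable_preimage => //; exact: measurable_cV_cons.
rewrite -comp_preimage; congr (_ _); congr (_ @^-1` A).
apply/funext => -[[z x] y] /=; rewrite /cV_cons/= (opp_col_mx (m1 := 1%N)).
by rewrite -raddfN.
Qed.

(** Pulling a cover of the source back along the left inverse [g] covers the target; pulling it back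
    once more along [f] returns the original sets, of finite measure. *)
Lemma sigma_finite_pushforward d1 d2 (X : measurableType d1)
    (Y : measurableType d2) (m : set X -> \bar R) (f : X -> Y) (g : Y -> X) :
  measurable_fun setT g -> cancel f g -> sigma_finite setT m ->
  sigma_finite setT (pushforward m f).
Proof.
move=> mg fK [F FT mF]; exists (fun k => g @^-1` F k).
  by rewrite -preimage_bigcup -FT preimage_setT.
move=> k; have [mFk Fk] := mF k; split; first exact: measurable_preimage.
rewrite /pushforward -comp_preimage (_ : g \o f = id)//.
by apply/funext => x /=; rewrite fK.
Qed.

Lemma sigma_finite_prod d1 d2 (X : measurableType d1) (Y : measurableType d2)
    (m1 : {sigma_finite_measure set X -> \bar R})
    (m2 : {sigma_finite_measure set Y -> \bar R}) :
  sigma_finite setT (m1 \x m2).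
Proof.
have /sigma_finiteP[F [FT Fnd mF]] := sigma_finiteT m1.
have /sigma_finiteP[G [GT Gnd mG]] := sigma_finiteT m2.
exists (fun k => F k `*` G k); last first.
  move=> k; have [mFk Fk] := mF k; have [mGk Gk] := mG k.
  split; first exact: measurableX.
  by rewrite product_measure1E// lte_mul_pinfty// ge0_fin_numE.
apply/esym/seteqP; split=> // -[x y] _.
have [i _ Fix] : (\bigcup_k F k) x by rewrite -FT.
have [j _ Gjy] : (\bigcup_k G k) y by rewrite -GT.
(* Both covers are increasing, so the rectangles with equal indices already exhaust the product. *)
exists (maxn i j) => //; split.
  exact: (subsetPset _ _ (Fnd _ _ (leq_maxl i j))).
exact: (subsetPset _ _ (Gnd _ _ (leq_maxr i j))).
Qed.

Lemma lebesgueC_sigma_finite p : sigma_finite setT (lebesgueC R p).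
Proof.
elim: p => [|p IH] /=.
  exact: sigma_finiteT.
pose m1 := sigma_finite_pack (sigma_finite_prod (sigma_finite_pack IH) lambda).
pose m2 := sigma_finite_pack (sigma_finite_prod m1 lambda).
(* The left inverse of [cV_cons]: it reads off the tail and the two real parts of the first
   coordinate. *)
apply: (@sigma_finite_pushforward _ _ _ _ m2 _ (fun z : 'cV[R[i]]_p.+1 =>
  (dsubmx (z : 'M[R[i]]_((1 + p)%N, 1)), complex.Re (z 0%R 0%R),
   complex.Im (z 0%R 0%R)))).
- apply: measurable_fun_pair; first apply: measurable_fun_pair.
  + apply: measurable_fun_mxP => i j; under eq_fun do rewrite mxE.
    exact: measurable_mxcoef.
  + by apply: measurable_fun_Re; exact: measurable_mxcoef.
  + by apply: measurable_fun_Im; exact: measurable_mxcoef.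
- move=> [[z x] y]; rewrite /cV_cons /= col_mxKd.
  have -> : (0 : 'I_p.+1)%R = lshift p (0 : 'I_1)%R by apply/val_inj.
  have -> : col_mx (x +i* y)%C%:M%R z (lshift p (0 : 'I_1)%R) 0%R = (x +i* y)%C.
    by rewrite (col_mxEu (m1 := 1%N)) mxE eqxx mulr1n.
  by [].
- exact: sigma_finiteT.
Qed.

End lebesgue_symmetries.

(** * Translation-invariant measures *)

Section translation_invariant_measures.
Local Open Scope ereal_scope.
Context {R : realType} (p : nat).
Local Notation V := 'cV[R[i]]_p.

(* Evaluate both products as [(m1 \x m2)] of the sets
   [{(x, y) | A x /\ B (y + x)}] and [{(x, y) | B x /\ A (x - y)}], whose
   sections at a fixed [y] are translates of each other. *)
Lemma translation_invariant_cross (m1 m2 : {sigma_finite_measure set V -> \bar R})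
    (A B : set V) :
  (forall b, preserves m1 (fun z : V => z + b)%R) ->
  (forall b, preserves m2 (fun z : V => z + b)%R) ->
  preserves m2 (fun z : V => - z)%R ->
  measurable A -> measurable B -> m1 A * m2 B = m1 B * m2 A.
Proof.
move=> m1D m2D [_ m2N] mA mB.
pose S := [set z : V * V | A z.1 /\ B (z.2 + z.1)%R].
pose S' := [set z : V * V | B z.1 /\ A (z.1 - z.2)%R].
have mS : measurable S.
  apply: measurableI; apply: measurable_preimage => //.
  by apply: measurable_fun_addmx; [exact: measurable_snd|exact: measurable_fst].
have mS' : measurable S'.
  apply: measurableI; apply: measurable_preimage => //.
  apply: measurable_fun_addmx; first exact: measurable_fst.
  by apply: measurable_fun_oppmx; exact: measurable_snd.
have indicE' (D : set V) (c : \bar R) (f : V -> \bar R) :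
    measurable D -> 0 <= c -> (forall x, D x -> f x = c) ->
    (forall x, ~ D x -> f x = 0) -> \int[m1]_x f x = m1 D * c.
  move=> mD c0 fD fDN; rewrite (eq_integral (fun x => (\1_D x)%:E * c)).
    by rewrite ge0_integralZr ?integral_indic ?setIT//; exact: measurableT_comp.
  move=> x _; rewrite indicE; have [/set_mem xD|/negP xD] := boolP (x \in D).
    by rewrite mul1e fD.
  by rewrite mul0e fDN// => Dx; apply: xD; exact/mem_set.
have -> : m1 A * m2 B = (m1 \x m2) S.
  symmetry; apply: indicE' => // x Ax /=.
    have [_ m2x] := m2D x; rewrite -[RHS]m2x//; congr (_ _).
    by apply/seteqP; split=> y; rewrite /xsection/= inE/= /S/= => //; case.
  rewrite (_ : xsection _ _ = set0) ?measure0//.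
  by apply/seteqP; split=> y //; rewrite /xsection/= inE /S/= => -[].
have -> : m1 B * m2 A = (m1 \x m2) S'.
  symmetry; apply: indicE' => // x Bx /=.
    (* The section of [S'] at [x] consists of the [y] with [x - y] in [A], a reflected translate of
       [A]; this is where invariance of [m2] under negation enters. *)
    have [_ m2x] := m2D x; rewrite -[RHS]m2x// -[RHS]m2N; last first.
      by apply: measurable_preimage => //; have [] := m2D x.
    congr (_ _); apply/seteqP; split=> y; rewrite /xsection/= inE/= /S'/= addrC//.
    by case.
  rewrite (_ : xsection _ _ = set0) ?measure0//.
  by apply/seteqP; split=> y //; rewrite /xsection/= inE /S'/= => -[].
(* Fubini: the product may be sliced along its second coordinate instead. *)
have prodE C : measurable C -> (m1 \x m2) C = (m1 \x^ m2) C.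
  apply: (product_measure_unique (m' := m1 \x^ m2)) => C1 C2 mC1 mC2.
  exact: product_measure2E.
rewrite !prodE// /product_measure2; apply: eq_integral => y _ /=.
have [_ m1y] := m1D y; rewrite -[RHS]m1y; last exact: measurable_ysection.
congr (_ _); apply/seteqP; split=> x; rewrite /ysection/= !inE /S /S'/= addrK;
  by rewrite addrC => -[].
Qed.

(** Otherwise the whole space would be a countable union of null sets. *)
Lemma exhaustion_positive d (X : measurableType d) (m : {measure set X -> \bar R})
    (F : (set X)^nat) :
  setT = \bigcup_k F k -> (forall k, measurable (F k)) -> 0 < m setT ->
  exists k, 0 < m (F k).
Proof.
move=> FT mF mT; apply: contrapT => /forallNP F0.
have /negligibleP : m.-negligible setT.
  rewrite FT; apply: negligible_bigcup => k; apply/negligibleP => //.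
  by apply/eqP; rewrite eq_le measure_ge0 leNgt andbT; exact/negP/F0.
by move=> /(_ measurableT) m0; rewrite m0 ltxx in mT.
Qed.

(** Fix in [translation_invariant_cross] a set [F k] of finite positive [m2]-measure and divide by
    [m2 (F k)]; the ratio [m1 (F k) / m2 (F k)] is the factor [K]. *)
Lemma translation_invariant_scale
    (m1 m2 : {sigma_finite_measure set V -> \bar R}) :
  (forall b, preserves m1 (fun z : V => z + b)%R) ->
  (forall b, preserves m2 (fun z : V => z + b)%R) ->
  preserves m2 (fun z : V => - z)%R -> 0 < m2 setT ->
  exists K : {nonneg R}, forall A, measurable A -> m1 A = K%:num%:E * m2 A.
Proof.
move=> m1D m2D m2N m2T.
have cross := translation_invariant_cross m1D m2D m2N.
have [F FT mF] := sigma_finiteT m2; have [G GT mG] := sigma_finiteT m1.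
have [k Fk0] := exhaustion_positive FT (fun k => (mF k).1) m2T.
have [l Gl0] := exhaustion_positive GT (fun k => (mG k).1) m2T.
have [mFk Fky] := mF k; have [mGl Gly] := mG l.
have Fkfin : m2 (F k) \is a fin_num by rewrite ge0_fin_numE.
(* If [m1 (F k)] were infinite, the cross relation with [G l], of finite [m1]-measure and positive
   [m2]-measure, would equate a finite product with an infinite one. *)
have m1Fk : m1 (F k) \is a fin_num.
  rewrite ge0_fin_numE// ltNge leye_eq; apply/negP => /eqP m1y.
  have := cross _ _ mGl mFk; rewrite m1y gt0_mulye// => Gy.
  have : m1 (G l) * m2 (F k) < +oo by rewrite lte_mul_pinfty// ge0_fin_numE.
  by rewrite Gy ltxx.
have K0 : (0 <= fine (m1 (F k)) / fine (m2 (F k)))%R.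
  by rewrite divr_ge0// fine_ge0.
exists (NngNum K0) => A mA /=.
rewrite EFinM fineK// muleAC -(cross _ _ mA mFk) -muleA.
rewrite -{1}(fineK Fkfin) -EFinM mulfV ?mule1// gt_eqF// fine_gt0// Fk0.
by rewrite Fky.
Qed.

End translation_invariant_measures.

(** * Lebesgue measure under invertible affine maps *)

Section lebesgueC_linear.
Local Open Scope ereal_scope.
Context {R : realType} (p : nat).
Local Notation la := (lebesgueC R p).

Lemma measurable_fun_affine (B : 'M[R[i]]_p) (b : 'cV[R[i]]_p) :
  measurable_fun setT (fun z : 'cV[R[i]]_p => B *m z + b)%R.
Proof.
apply: measurable_fun_addmx; last exact: measurable_cst.
by apply: measurable_fun_mulmx => //; exact: measurable_cst.
Qed.

(** The image of Lebesgue measure is again translation invariant: a shift by [c] after the map is a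
    shift by [invmx B *m c] before it. The factor [K] stays abstract and is absorbed into the
    normalizing constant in [ces_affine]. *)
Lemma lebesgueC_affine (B : 'M[R[i]]_p) (b : 'cV[R[i]]_p) :
  B \in unitmx -> 0 < la setT ->
  exists K : {nonneg R}, forall A, measurable A ->
    la ((fun z : 'cV[R[i]]_p => B *m z + b)%R @^-1` A) = K%:num%:E * la A.
Proof.
move=> Bu laT; pose phi (z : 'cV[R[i]]_p) := (B *m z + b)%R.
have mphi : measurable_fun setT phi by exact: measurable_fun_affine.
have sf := @lebesgueC_sigma_finite R p.
have phi_sf : sigma_finite setT (pushforward_measure la mphi).
  apply: (@sigma_finite_pushforward _ _ _ _ _ la _
    (fun z : 'cV[R[i]]_p => invmx B *m z + (- (invmx B *m b)))%R) => //.
    exact: measurable_fun_affine.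
  by move=> z; rewrite /phi mulmxDr mulKmx// addrK.
apply: (translation_invariant_scale (m1 := sigma_finite_pack phi_sf)
  (m2 := sigma_finite_pack sf)) => //.
- move=> c; split.
    by apply: measurable_fun_addmx => //; exact: measurable_cst.
  move=> A mA.
  change (la (phi @^-1` ((fun z => z + c)%R @^-1` A)) = la (phi @^-1` A)).
  have [_ shift] := lebesgueC_preserves_shift (invmx B *m c)%R.
  rewrite -[RHS]shift; last exact: measurable_preimage.
  rewrite -[_ @^-1` (phi @^-1` A)]comp_preimage -[in LHS]comp_preimage.
  rewrite (_ : _ \o phi = phi \o (fun z => z + invmx B *m c)%R)//.
  by apply/funext => z /=; rewrite /phi mulmxDr mulKVmx// addrAC.
- exact: lebesgueC_preserves_shift.
- exact: lebesgueC_preserves_opp.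
Qed.

End lebesgueC_linear.

(** * Affine images of elliptical laws *)

Lemma adjmxM (C : numClosedFieldType) m n k (A : 'M[C]_(m, n)) (B : 'M[C]_(n, k)) :
  (A *m B)^t* = B^t* *m A^t*.
Proof. by rewrite trmx_mul map_mxM. Qed.

Section ces_law.
Local Open Scope ereal_scope.
Context {R : realType} (p : nat).
Local Notation V := 'cV[R[i]]_p.
Local Notation la := (lebesgueC R p).

Lemma Re_ge0 (z : R[i]) : (0 <= z -> 0 <= complex.Re z)%R.
Proof. by rewrite lecE /= => /andP[]. Qed.

Lemma sqnorm_ge0 (z : V) : (0 <= complex.Re ((z^t* *m z) 0 0))%R.
Proof.
apply: Re_ge0; rewrite mxE sumr_ge0// => i _.
by rewrite !mxE mulrC; exact: mul_conjC_ge0.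
Qed.

Definition spherical_density (g : R -> R) (z : V) : R :=
  g (complex.Re ((z^t* *m z) 0%R 0%R)).

Lemma measurable_spherical_density (g : R -> R) : density_generator g ->
  measurable_fun setT (fun z : V => (spherical_density g z)%:E).
Proof.
move=> [mg _]; apply/measurable_EFinP.
(* [g] is known to be measurable on the half-line only, so it is extended by zero; squared norms
   never leave the half-line. *)
have -> : spherical_density g = (g \_ `[0%R, +oo[) \o
    (fun z : V => complex.Re ((z^t* *m z) 0%R 0%R)).
  by apply/funext => z /=; rewrite patchE mem_set//= in_itv/= andbT sqnorm_ge0.
apply: measurableT_comp; first
  exact: (measurable_restrictT _ (measurable_itv _)).1 mg.
apply: measurable_fun_Re; apply: measurable_fun_mxcoef.
by apply: measurable_fun_mulmx => //; exact: measurable_fun_adjmx.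
Qed.

Lemma spherical_density_ge0 (g : R -> R) (z : V) : density_generator g ->
  0 <= (spherical_density g z)%:E.
Proof. by move=> [_ g0]; rewrite lee_fin ltW// g0// sqnorm_ge0. Qed.

(** With [Sigma] written as B B^H, its inverse is the Gram matrix of [invmx B], so the quadratic
    form is the squared norm of [invmx B *m (y - mu)]. The determinant, equal to |det B|^2 and hence
    nonnegative, goes into the constant. *)
Lemma ces_proportional (g : R -> R) d (T : measurableType d)
    (P : probability T R) (x : T -> V) mu Sigma (B : 'M[R[i]]_p) :
  density_generator g -> ces P x mu Sigma g -> B \in unitmx ->
  B *m B^t* = Sigma ->
  exists2 a : R, (0 <= a)%R & forall A, measurable A ->
    P (x @^-1` A) = a%:E * \int[la]_(y in A)
      (spherical_density g (invmx B *m y - invmx B *m mu)%R)%:E.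
Proof.
move=> gg [_ _ _ _ _ [c c0 xE]] Bu BE.
have B'u : B^t* \in unitmx by rewrite map_unitmx unitmx_tr.
have det0 : (0 <= complex.Re (\det Sigma))%R.
  by apply: Re_ge0; rewrite -BE det_mulmx det_map_mx det_tr mul_conjC_ge0.
exists (c * (complex.Re (\det Sigma))^-1)%R.
  by rewrite mulr_ge0 ?invr_ge0// ltW.
move=> A mA; rewrite xE// -ge0_integralZl_EFin//; last 3 first.
- by move=> y _; exact: spherical_density_ge0.
- apply: measurable_funTS.
  apply: (measurableT_comp (measurable_spherical_density gg)).
  exact: measurable_fun_affine.
- by rewrite mulr_ge0 ?invr_ge0// ltW.
apply: eq_integral => y _; rewrite -EFinM /ces_density /spherical_density mulrA.
congr (_ * g (complex.Re (fun_of_matrix _ _ _)))%:E.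
rewrite -mulmxBr adjmxM -!mulmxA; congr (_ *m _)%R; rewrite !mulmxA.
congr (_ *m _)%R; rewrite -BE.
rewrite trmx_inv map_invmx.
have BBu : (B *m B^t*)%R \in unitmx by rewrite unitmx_mul Bu.
apply: (can_inj (mulmxK BBu)); rewrite mulVmx// mulmxA.
by rewrite (mulmxKV Bu) mulVmx.
Qed.

(** Both laws have densities proportional to the spherical density taken at [invmx B *m (y - mu)]:
    the first by [ces_proportional], the second by a change of variables. Both have total mass 1, so
    the constants agree. *)
Lemma ces_affine (g : R -> R) d (T : measurableType d) (P : probability T R)
    (x : T -> V) mu Sigma d0 (T0 : measurableType d0) (P0 : probability T0 R)
    (x0 : T0 -> V) (B : 'M[R[i]]_p) :
  density_generator g -> ces P x mu Sigma g -> ces P0 x0 0%R 1%:M%R g ->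
  B \in unitmx -> B *m B^t* = Sigma ->
  forall A, measurable A ->
    P (x @^-1` A) = P0 ((fun w => B *m x0 w + mu)%R @^-1` A).
Proof.
move=> gg Px Px0 Bu BE.
have [a a0 xE] := ces_proportional gg Px Bu BE.
have [b b0 x0E] : exists2 b : R, (0 <= b)%R & forall A, measurable A ->
    P0 (x0 @^-1` A) = b%:E * \int[la]_(y in A) (spherical_density g y)%:E.
  have [||b b0 x0E] := ces_proportional (B := 1%:M%R) gg Px0.
  - exact: unitmx1.
  - by rewrite trmx1 map_mx1 mulmx1.
  exists b => // A /x0E ->; congr (_ * _); apply: eq_integral => y _.
  by rewrite invmx1 !mul1mx subr0.
have mf := measurable_spherical_density gg.
(* If Lebesgue measure vanished, the density of [x0] would integrate to 0 instead of 1. *)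
have laT : 0 < la setT.
  rewrite lt_neqAle measure_ge0 andbT; apply/eqP => la0.
  have := x0E _ measurableT; rewrite preimage_setT probability_setT.
  have := null_set_integral measurableT mf (esym la0).
  by move=> ->; rewrite mule0 => /eqP; rewrite onee_eq0.
have [K KE] := lebesgueC_affine mu Bu laT.
pose phi (z : V) := (B *m z + mu)%R.
have mphi : measurable_fun setT phi by exact: measurable_fun_affine.
pose psi (y : V) := (invmx B *m y - invmx B *m mu)%R.
have mpsi : measurable_fun setT psi by exact: measurable_fun_affine.
have Px0E A : measurable A -> P0 ((phi \o x0) @^-1` A) =
    (b * K%:num)%:E * \int[la]_(y in A) (spherical_density g (psi y))%:E.
  move=> mA; rewrite comp_preimage x0E; last exact: measurable_preimage.
  rewrite EFinM -muleA; congr (_ * _).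
  rewrite -ge0_integral_mscale//; last 2 first.
  - by apply: measurable_funTS; exact: (measurableT_comp mf mpsi).
  - by move=> y _; exact: spherical_density_ge0.
  rewrite -(ge0_integral_image (m := la) (phi := phi) (f := fun y =>
    (spherical_density g (psi y))%:E))//.
  - apply: eq_integral => z _; rewrite /psi /phi mulmxDr mulKmx//.
    by rewrite addrK.
  - exact: (measurableT_comp mf mpsi).
  - by move=> y; exact: spherical_density_ge0.
(* The common integral [I] satisfies [a * I = 1] and [b * K * I = 1]. A zero integral contradicts
   this, and so does an infinite one, where the first product is 0 or infinite. *)
have ab : a = (b * K%:num)%R.
  have := xE _ measurableT; have := Px0E _ measurableT.
  rewrite !preimage_setT !probability_setT -/psi.
  have := integral_ge0 la (D := setT)
    (fun y _ => spherical_density_ge0 (psi y) gg).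
  case: (\int[la]_y _) => [I| |]//.
  - rewrite -!EFinM => I0 [bI] [aI]; have In0 : I != 0%R.
      by apply/eqP => I00; move: aI; rewrite I00 mulr0 => /eqP; rewrite oner_eq0.
    by apply: (mulIf In0); rewrite -bI -aI.
  - move=> _ _; have [->|an0] := eqVneq a 0%R.
      by rewrite mul0e => /eqP; rewrite onee_eq0.
    by rewrite gt0_muley// ?lte_fin ?lt_neqAle ?a0 ?andbT 1?eq_sym.
by move=> A mA; rewrite xE// ab -Px0E.
Qed.

End ces_law.

(** * The joint law of the rows of a data matrix *)

Section matrix_laws.
Local Open Scope ereal_scope.
Context {R : realType} (n p : nat).
Local Notation V := 'cV[R[i]]_p.

(** Observations are columns but fill the rows of the data matrix, hence the transpose. These sets
    form the pi-system on which independence computes probabilities. *)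
Definition row_rectangle (B : 'I_n -> set V) : set 'M[R[i]]_(n, p) :=
  [set M | forall k, B k (row k M)^T].

Let rectangles : set (set 'M[R[i]]_(n, p)) :=
  [set row_rectangle B | B in [set B | forall k, measurable (B k)]].

Lemma measurable_row_rectangle (B : 'I_n -> set V) :
  (forall k, measurable (B k)) -> measurable (row_rectangle B).
Proof.
move=> mB; rewrite (_ : row_rectangle B =
    \bigcap_(k in [set: 'I_n]) (fun M : 'M[R[i]]_(n, p) => (row k M)^T) @^-1` B k).
  apply: fin_bigcap_measurable => // k _; apply: measurable_preimage => //.
  apply: measurable_fun_mxP => i j; under eq_fun do rewrite !mxE.
  exact: measurable_mxcoef.
by apply/seteqP; split=> M MB k; [move=> _; exact: MB|exact: MB].
Qed.

Lemma measurable_rectanglesE :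
  @measurable _ 'M[R[i]]_(n, p) = <<s rectangles >>.
Proof.
apply/seteqP; split; last first.
  apply: smallest_sub; first exact: sigma_algebra_measurable.
  by move=> _ [B mB <-]; exact: measurable_row_rectangle.
apply: smallest_sub; first exact: smallest_sigma_algebra.
move=> _ [[i j] _ [A mA <-]]; rewrite setTI; apply: sub_sigma_algebra.
(* A condition on one entry is a rectangle constraining only the row of that entry. *)
exists (fun k => if k == i then [set v : V | A (v j 0%R)] else setT).
  move=> k; case: eqP => // _.
  by apply: (measurable_preimage (measurable_mxcoef j 0%R)).
apply/seteqP; split=> M /=; last first.
  by move=> MA k; case: eqP => // -> /=; rewrite !mxE.
by move/(_ i); rewrite eqxx /= !mxE.
Qed.

Lemma data_mx_row d (T : measurableType d) (x : 'I_n -> T -> V) w k :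
  (row k (data_mx x w))^T = x k w.
Proof. by apply/matrixP => i j; rewrite !mxE ord1. Qed.

Lemma measurable_data_mx d (T : measurableType d) (x : 'I_n -> T -> V) :
  (forall k, measurable_fun setT (x k)) -> measurable_fun setT (data_mx x).
Proof.
move=> mx; apply: measurable_fun_mxP => i j.
rewrite /data_mx; under eq_fun do rewrite mxE.
exact: measurable_fun_mxcoef.
Qed.

(** On row rectangles independence gives the product of the marginal probabilities, which agree; a
    probability is determined by its values on this generating pi-system. *)
Lemma sample_law d (T : measurableType d) (P : probability T R)
    (x : 'I_n -> T -> V) d' (T' : measurableType d') (P' : probability T' R)
    (y : 'I_n -> T' -> V) :
  (forall k, measurable_fun setT (x k)) ->
  (forall k, measurable_fun setT (y k)) ->
  mutually_independent P x -> mutually_independent P' y ->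
  (forall k A, measurable A -> P (x k @^-1` A) = P' (y k @^-1` A)) ->
  forall A, measurable A -> P (data_mx x @^-1` A) = P' (data_mx y @^-1` A).
Proof.
move=> mx my xI yI xy A mA.
have lawE (B : 'I_n -> set V) d1 (T1 : measurableType d1)
    (P1 : probability T1 R) (z : 'I_n -> T1 -> V) :
    mutually_independent P1 z -> (forall k, measurable (B k)) ->
    P1 (data_mx z @^-1` row_rectangle B) = \prod_(k in [set: 'I_n]%SET)
      P1 (z k @^-1` B k).
  move=> zI mB; rewrite -zI//; congr (P1 _).
  by apply/seteqP; split=> w zB k; [move=> _|]; have := zB k;
    rewrite ?data_mx_row//=; apply; rewrite inE.
apply: (measure_unique rectangles (fun=> setT)
  measurable_rectanglesE _ _ _ (pushforward_measure P (measurable_data_mx mx))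
  (pushforward_measure P' (measurable_data_mx my))) => //.
- move=> _ _ [B mB <-] [C mC <-]; exists (fun k => B k `&` C k).
    by move=> k; exact: measurableI.
  by apply/seteqP; split=> M; [move=> BC; split=> k; case: (BC k)|
    move=> [MB MC] k; split].
- by move=> _; exists (fun=> setT) => //; apply/seteqP; split.
- by rewrite bigcup_const//; exists 0%N.
- move=> _ [B mB <-]; rewrite /= /pushforward/= !lawE//.
  by apply: eq_bigr => k _; exact: xy.
- by move=> _; rewrite /= /pushforward preimage_setT probability_setT ltry.
Qed.

Lemma mutually_independent_comp d (T : measurableType d) (P : probability T R)
    (x : 'I_n -> T -> V) (f : V -> V) : measurable_fun setT f ->
  mutually_independent P x -> mutually_independent P (fun k w => f (x k w)).
Proof.
move=> mf xI J B mB.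
by apply: (xI J (fun k => f @^-1` B k)) => k; exact: measurable_preimage.
Qed.

End matrix_laws.

(** * Complex expectations and covariances *)

Section complex_expectation.
Context {R : realType} d (T : measurableType d) (P : probability T R).
Implicit Types X Y : T -> R[i].

Lemma sqr_normcE (z : R[i]) :
  Normc.normc z ^+ 2 = complex.Re z ^+ 2 + complex.Im z ^+ 2.
Proof. by case: z => a b /=; rewrite sqr_sqrtr// addr_ge0// sqr_ge0. Qed.

Lemma ReM (z w : R[i]) : complex.Re (z * w) =
  complex.Re z * complex.Re w - complex.Im z * complex.Im w.
Proof. by case: z w => [a b] [a' b']. Qed.

Lemma ImM (z w : R[i]) : complex.Im (z * w) =
  complex.Re z * complex.Im w + complex.Im z * complex.Re w.
Proof. by case: z w => [a b] [a' b']. Qed.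

Definition integrableC X : Prop :=
  P.-integrable setT (EFin \o (fun w => complex.Re (X w))) /\
  P.-integrable setT (EFin \o (fun w => complex.Im (X w))).

Lemma cexpE X : cexp P X =
  ((\int[P]_w complex.Re (X w)) +i* (\int[P]_w complex.Im (X w)))%C.
Proof. by rewrite /cexp unlock. Qed.

Lemma integrableC_add X Y : integrableC X -> integrableC Y ->
  integrableC (fun w => X w + Y w).
Proof.
move=> [Xr Xi] [Yr Yi]; split.
- rewrite (_ : _ \o _ = (EFin \o (fun w => complex.Re (X w))) \+
    (EFin \o (fun w => complex.Re (Y w))))%E; first exact: integrableD.
  by apply/funext => w /=; rewrite raddfD.
- rewrite (_ : _ \o _ = (EFin \o (fun w => complex.Im (X w))) \+
    (EFin \o (fun w => complex.Im (Y w))))%E; first exact: integrableD.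
  by apply/funext => w /=; rewrite raddfD.
Qed.

Lemma integrableC_cst (c : R[i]) : integrableC (fun=> c).
Proof. by split; exact: finite_measure_integrable_cst. Qed.

Lemma integrableCZ (c : R[i]) X : integrableC X -> integrableC (fun w => c * X w).
Proof.
move=> [Xr Xi]; split.
- rewrite (_ : _ \o _ = (fun w => (complex.Re c)%:E * (complex.Re (X w))%:E) \+
    (fun w => (- complex.Im c)%:E * (complex.Im (X w))%:E))%E.
    by apply: integrableD => //; exact: integrableZl.
  by apply/funext => w /=; rewrite ReM EFinD EFinM -mulNr EFinM.
- rewrite (_ : _ \o _ = (fun w => (complex.Re c)%:E * (complex.Im (X w))%:E) \+
    (fun w => (complex.Im c)%:E * (complex.Re (X w))%:E))%E.
    by apply: integrableD => //; exact: integrableZl.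
  by apply/funext => w /=; rewrite ImM EFinD !EFinM.
Qed.

Lemma integrableC_sum (I : Type) (s : seq I) (h : I -> T -> R[i]) :
  (forall i, integrableC (h i)) -> integrableC (fun w => \sum_(i <- s) h i w).
Proof.
move=> hi; elim: s => [|i s IH].
  by under eq_fun do rewrite big_nil; exact: integrableC_cst.
by under eq_fun do rewrite big_cons; exact: integrableC_add.
Qed.

Lemma cexp_cst (c : R[i]) : cexp P (fun=> c) = c.
Proof. by rewrite /cexp !expectation_cst; case: c. Qed.

Lemma cexpD X Y : integrableC X -> integrableC Y ->
  cexp P (fun w => X w + Y w) = cexp P X + cexp P Y.
Proof.
move=> [Xr Xi] [Yr Yi]; rewrite !cexpE.
under eq_Rintegral do rewrite raddfD.
rewrite RintegralD//.
under [X in (_ +i* X)%C = _]eq_Rintegral do rewrite raddfD.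
by rewrite RintegralD.
Qed.

Lemma cexpZ (c : R[i]) X : integrableC X ->
  cexp P (fun w => c * X w) = c * cexp P X.
Proof.
move=> [Xr Xi]; rewrite !cexpE.
have intZ (a : R) (f : T -> R) : P.-integrable setT (EFin \o f) ->
    P.-integrable setT (EFin \o (fun w => a * f w)).
  by move=> fi; rewrite (_ : _ \o _ = fun w => a%:E * (EFin \o f) w)%E;
    [exact: integrableZl|exact/funext].
under eq_Rintegral do rewrite ReM.
rewrite RintegralB ?RintegralZl//; try exact: intZ.
under [X in (_ +i* X)%C = _]eq_Rintegral do rewrite ImM.
rewrite RintegralD ?RintegralZl//; try exact: intZ.
by case: c.
Qed.

Lemma cexp_sum (I : Type) (s : seq I) (h : I -> T -> R[i]) :
  (forall i, integrableC (h i)) ->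
  cexp P (fun w => \sum_(i <- s) h i w) = \sum_(i <- s) cexp P (h i).
Proof.
move=> hi; elim: s => [|i s IH].
  by under eq_fun do rewrite big_nil; rewrite cexp_cst big_nil.
under eq_fun do rewrite big_cons.
by rewrite cexpD ?IH ?big_cons//; exact: integrableC_sum.
Qed.

Lemma cexp_conj X : integrableC X ->
  cexp P (fun w => Num.conj (X w)) = Num.conj (cexp P X).
Proof.
move=> [Xr Xi]; rewrite !cexpE; congr (_ +i* _)%C.
  by apply: eq_Rintegral => w _; case: (X w).
rewrite (@eq_Rintegral _ _ _ P setT (fun w => -1 * complex.Im (X w))).
  by rewrite RintegralZl// mulN1r.
by move=> w _; case: (X w) => a b; rewrite mulN1r.
Qed.

(** Nonnegativity in the partial order of [R[i]] forces the imaginary part to vanish pointwise. An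
    infinite integral of the real part is sent to 0 by [fine], which is still nonnegative. *)
Lemma cexp_ge0 X : (forall w, 0 <= X w) -> 0 <= cexp P X.
Proof.
move=> X0; rewrite cexpE lecE /=; apply/andP; split.
  rewrite (@eq_Rintegral _ _ _ P setT (fun=> 0)) ?Rintegral_cst ?mul0r//.
  by move=> w _; have := X0 w; rewrite lecE => /andP[/eqP].
by apply: Rintegral_ge0 => w _; exact: Re_ge0.
Qed.

(** Integrability of the squared modulus does not make [X] itself measurable, so measurability is a
    separate conjunct. *)
Definition square_integrable X : Prop :=
  measurable_fun setT X /\ finite_moment P 2 X.

Lemma finite_moment2_le X (Y : T -> R) : measurable_fun setT X ->
  P.-integrable setT (EFin \o Y) ->
  (forall w, Normc.normc (X w) ^+ 2 <= Y w) -> finite_moment P 2 X.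
Proof.
move=> mX Yi XY; apply: (le_integrable _ _ _ Yi) => //.
  apply/measurable_EFinP; under eq_fun do rewrite sqr_normcE.
  by apply: measurable_funD; apply: measurable_funX;
    [exact: measurable_fun_Re|exact: measurable_fun_Im].
have X0 w : 0 <= Normc.normc (X w) ^+ 2 by rewrite sqr_normcE addr_ge0 ?sqr_ge0.
by move=> w _ /=; rewrite lee_fin !ger0_norm// (le_trans _ (XY w)).
Qed.

Lemma square_integrable_cst (c : R[i]) : square_integrable (fun=> c).
Proof.
by split; [exact: measurable_cst|exact: finite_measure_integrable_cst].
Qed.

Lemma square_integrableD X Y : square_integrable X -> square_integrable Y ->
  square_integrable (fun w => X w + Y w).
Proof.
move=> [mX Xi] [mY Yi]; split; first exact: measurable_fun_cadd.
apply: (finite_moment2_le (Y := fun w =>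
  2 * Normc.normc (X w) ^+ 2 + 2 * Normc.normc (Y w) ^+ 2)).
- exact: measurable_fun_cadd.
- rewrite (_ : _ \o _ = (fun w => 2%:E * (Normc.normc (X w) ^+ 2)%:E) \+
    (fun w => 2%:E * (Normc.normc (Y w) ^+ 2)%:E))%E; last exact/funext.
  by apply: integrableD => //; exact: integrableZl.
- move=> w; rewrite !sqr_normcE !raddfD/=.
  have := sqr_ge0 (complex.Re (X w) - complex.Re (Y w)).
  have := sqr_ge0 (complex.Im (X w) - complex.Im (Y w)).
  nra.
Qed.

Lemma square_integrableZ (c : R[i]) X : square_integrable X ->
  square_integrable (fun w => c * X w).
Proof.
move=> [mX Xi]; have mcX : measurable_fun setT (fun w => c * X w).
  by apply: measurable_fun_cmul => //; exact: measurable_cst.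
split=> //; apply: (finite_moment2_le (Y := fun w =>
  Normc.normc c ^+ 2 * Normc.normc (X w) ^+ 2)) => //.
- rewrite (_ : _ \o _ = fun w =>
    ((Normc.normc c ^+ 2)%:E * (Normc.normc (X w) ^+ 2)%:E))%E; last exact/funext.
  exact: integrableZl.
- by move=> w; rewrite Normc.normcM exprMn.
Qed.

Lemma square_integrable_sum (I : Type) (s : seq I) (h : I -> T -> R[i]) :
  (forall i, square_integrable (h i)) ->
  square_integrable (fun w => \sum_(i <- s) h i w).
Proof.
move=> hi; elim: s => [|i s IH].
  by under eq_fun do rewrite big_nil; exact: square_integrable_cst.
by under eq_fun do rewrite big_cons; exact: square_integrableD.
Qed.

Lemma square_integrable_conj X : square_integrable X ->
  square_integrable (fun w => Num.conj (X w)).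
Proof.
move=> [mX Xi]; split; first exact: measurable_fun_conj.
rewrite /finite_moment (_ : (fun _ => _) =
  (fun w => (Normc.normc (X w) ^+ 2)%:E))//.
by apply/funext => w; rewrite !sqr_normcE; case: (X w) => a b /=; rewrite sqrrN.
Qed.

(** Both parts of the product are dominated by [|X|^2 + |Y|^2]; the squares of sums and differences
    below are the facts from which [nra] derives the bounds. *)
Lemma integrableC_mul X Y : square_integrable X -> square_integrable Y ->
  integrableC (fun w => X w * Y w).
Proof.
move=> [mX Xi] [mY Yi].
have XYi : P.-integrable setT (EFin \o (fun w =>
    Normc.normc (X w) ^+ 2 + Normc.normc (Y w) ^+ 2)).
  rewrite (_ : _ \o _ = (fun w => (Normc.normc (X w) ^+ 2)%:E) \+
    (fun w => (Normc.normc (Y w) ^+ 2)%:E))%E; last exact/funext.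
  exact: integrableD.
have mXY := measurable_fun_cmul mX mY.
split; apply: (le_integrable _ _ _ XYi) => //=.
- by apply/measurable_EFinP; exact: measurable_fun_Re.
- move=> w _; rewrite lee_fin [leRHS]ger0_norm; last first.
    by rewrite !sqr_normcE !addr_ge0// sqr_ge0.
  rewrite ReM !sqr_normcE ler_norml.
  set a := complex.Re (X w); set b := complex.Im (X w).
  set e := complex.Re (Y w); set f := complex.Im (Y w).
  have := sqr_ge0 (a + e); have := sqr_ge0 (a - e).
  have := sqr_ge0 (b + f); have := sqr_ge0 (b - f).
  have := sqr_ge0 a; have := sqr_ge0 b; have := sqr_ge0 e; have := sqr_ge0 f.
  by move=> *; apply/andP; split; nra.
- by apply/measurable_EFinP; exact: measurable_fun_Im.
- move=> w _; rewrite lee_fin [leRHS]ger0_norm; last first.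
    by rewrite !sqr_normcE !addr_ge0// sqr_ge0.
  rewrite ImM !sqr_normcE ler_norml.
  set a := complex.Re (X w); set b := complex.Im (X w).
  set e := complex.Re (Y w); set f := complex.Im (Y w).
  have := sqr_ge0 (a + f); have := sqr_ge0 (a - f).
  have := sqr_ge0 (b + e); have := sqr_ge0 (b - e).
  have := sqr_ge0 a; have := sqr_ge0 b; have := sqr_ge0 e; have := sqr_ge0 f.
  by move=> *; apply/andP; split; nra.
Qed.

Lemma square_integrableC X : square_integrable X -> integrableC X.
Proof.
move=> Xi; rewrite (_ : X = fun w => X w * 1).
  by apply: integrableC_mul => //; exact: square_integrable_cst.
by apply/funext => w; rewrite mulr1.
Qed.

End complex_expectation.

(** * Expectations depend only on the law *)

Section expectation_of_law.
Context {R : realType} d (T : measurableType d) (P : probability T R).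
Context d' (T' : measurableType d') (P' : probability T' R).
Context e (U : measurableType e) (X : T -> U) (Y : T' -> U).
Hypotheses (mX : measurable_fun setT X) (mY : measurable_fun setT Y).
Hypothesis XY : forall A, measurable A -> P (X @^-1` A) = P' (Y @^-1` A).

Lemma ge0_integral_law (f : U -> \bar R) : measurable_fun setT f ->
  (forall u, 0 <= f u)%E ->
  (\int[P]_w f (X w) = \int[P']_w f (Y w))%E.
Proof.
move=> mf f0; rewrite -[setT in LHS](preimage_setT X).
rewrite (ge0_integral_image (m' := pushforward_measure P' mY))//.
by rewrite ge0_integral_pushforward// preimage_setT.
Qed.

Lemma Rintegral_law (f : U -> R) : measurable_fun setT f ->
  \int[P]_w f (X w) = \int[P']_w f (Y w).
Proof.
move=> mf; have mEf : measurable_fun setT (EFin \o f) by exact/measurable_EFinP.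
rewrite /Rintegral integralE [in RHS]integralE; congr (fine (_ - _)).
  have := ge0_integral_law (measurable_funepos mEf) (@funepos_ge0 _ _ _).
  by rewrite !unlock.
have := ge0_integral_law (measurable_funeneg mEf) (@funeneg_ge0 _ _ _).
by rewrite !unlock.
Qed.

Lemma cexp_law (f : U -> R[i]) : measurable_fun setT f ->
  cexp P (fun w => f (X w)) = cexp P' (fun w => f (Y w)).
Proof.
move=> mf; rewrite !cexpE; congr (_ +i* _)%C.
  by apply: (Rintegral_law (f := fun u => complex.Re (f u)));
    exact: measurable_fun_Re.
by apply: (Rintegral_law (f := fun u => complex.Im (f u)));
  exact: measurable_fun_Im.
Qed.

Lemma square_integrable_law (f : U -> R[i]) : measurable_fun setT f ->
  square_integrable P (fun w => f (X w)) ->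
  square_integrable P' (fun w => f (Y w)).
Proof.
move=> mf [_ /integrableP[_ fX]]; split; first exact: measurableT_comp.
have mnf : measurable_fun setT (fun u => (Normc.normc (f u) ^+ 2)%:E).
  apply/measurable_EFinP; under eq_fun do rewrite sqr_normcE.
  by apply: measurable_funD; apply: measurable_funX;
    [exact: measurable_fun_Re|exact: measurable_fun_Im].
apply/integrableP; split; first exact: (measurableT_comp mnf mY).
rewrite -(ge0_integral_law (f := fun u => `|(Normc.normc (f u) ^+ 2)%:E|%E))//.
exact: measurableT_comp.
Qed.

End expectation_of_law.

(** * Sesquilinearity of the covariance *)

Section covariance.
Context {R : realType} d (T : measurableType d) (P : probability T R).
Implicit Types X Y : T -> R[i].

Lemma ccovZ (a b : R[i]) X Y : square_integrable P X -> square_integrable P Y ->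
  ccov P (fun w => a * X w) (fun w => b * Y w) = a * Num.conj b * ccov P X Y.
Proof.
move=> Xi Yi; have := square_integrableC Xi; have := square_integrableC Yi.
move=> Yi1 Xi1; rewrite /ccov !cexpZ// -[RHS]cexpZ; last first.
  apply: integrableC_mul.
    by apply: square_integrableD => //; exact: square_integrable_cst.
  apply: square_integrable_conj.
  by apply: square_integrableD => //; exact: square_integrable_cst.
congr (cexp P _); apply/funext => w.
by rewrite -!mulrBr rmorphM/= mulrACA.
Qed.

Lemma ccov_sum (I : finType) (h : I -> T -> R[i]) (a b : I -> R[i]) :
  (forall q, square_integrable P (h q)) ->
  ccov P (fun w => \sum_q a q * h q w) (fun w => \sum_r b r * h r w) =
  \sum_q \sum_r a q * Num.conj (b r) * ccov P (h q) (h r).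
Proof.
move=> hi; have hC q : square_integrable P (fun w => h q w - cexp P (h q)).
  by apply: square_integrableD => //; exact: square_integrable_cst.
(* Centring commutes with linear combinations. *)
have mean (e : I -> R[i]) w :
    \sum_q e q * h q w - cexp P (fun w => \sum_q e q * h q w)
    = \sum_q e q * (h q w - cexp P (h q)).
  rewrite cexp_sum; last first.
    by move=> q; apply: integrableCZ; exact: square_integrableC.
  rewrite -sumrB; apply: eq_bigr => q _.
  by rewrite cexpZ ?mulrBr//; exact: square_integrableC.
have covi q r : integrableC P (fun w => (h q w - cexp P (h q)) *
    Num.conj (h r w - cexp P (h r))).
  by apply: integrableC_mul => //; exact: square_integrable_conj.
rewrite /ccov; under [in LHS]eq_fun do rewrite !mean rmorph_sum /= big_distrlr /=.
rewrite cexp_sum; last first.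
  move=> q; apply: integrableC_sum => r.
  under eq_fun do rewrite rmorphM /= mulrACA.
  exact: integrableCZ.
apply: eq_bigr => q _; rewrite cexp_sum; last first.
  by move=> r; under eq_fun do rewrite rmorphM /= mulrACA; exact: integrableCZ.
apply: eq_bigr => r _; under [in LHS]eq_fun do rewrite rmorphM /= mulrACA.
by rewrite cexpZ.
Qed.

End covariance.

(** * Unitarily invariant random matrices *)

(** A single sum over index pairs is the shape expected by [ccov_sum] and
    [isotropic_contraction]. *)
Lemma sandwichE (C : numClosedFieldType) p (A M : 'M[C]_p) i j :
  (A *m M *m A^t*) i j =
  \sum_q (A i q.1 * Num.conj (A j q.2)) * M q.1 q.2.
Proof.
rewrite mxE -(pair_big xpredT xpredT
  (fun a b => (A i a * Num.conj (A j b)) * M a b)) exchange_big /=.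
apply: eq_bigr => b _; rewrite mxE mulr_suml; apply: eq_bigr => a _.
by rewrite !mxE mulrAC.
Qed.

(** Double transitivity of the symmetric group: first send [j] to the preimage of [b] under the swap
    of [i] and [a], which fixes [i], then apply that swap. *)
Lemma ord_pair_transitive p (i j a b : 'I_p) : i != j -> a != b ->
  exists s : 'S_p, s i = a /\ s j = b.
Proof.
rewrite eq_sym => ji ab; pose t := tperm i a.
have tb : t b != i by rewrite -(tpermR i a) (inj_eq perm_inj) eq_sym.
exists (tperm j (t b) * t)%g; rewrite !permM tpermL tpermK; split=> //.
by rewrite [tperm j _ i]tpermD// tpermL.
Qed.

(** The three terms are the identity on index pairs, the product of two traces, and the fully
    diagonal part, which is the anisotropic remainder that unitary invariance will force to
    vanish. *)
Lemma isotropic_contraction (R : comNzRingType) (I : finType) (e f h : R)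
    (a b : I * I -> R) :
  \sum_q \sum_r a q * b r * (e * (q == r)%:R
      + f * ((q.1 == q.2) && (r.1 == r.2))%:R
      + h * ((q == r) && (q.1 == q.2))%:R) =
  e * (\sum_q a q * b q) + f * ((\sum_i a (i, i)) * (\sum_i b (i, i)))
    + h * (\sum_i a (i, i) * b (i, i)).
Proof.
have diagE (g : I * I -> R) :
    \sum_q g q * (q.1 == q.2)%:R = \sum_i g (i, i).
  transitivity (\sum_i \sum_j g (i, j) * (i == j)%:R).
    by rewrite pair_bigA /=; apply: eq_bigr => -[].
  apply: eq_bigr => i _; rewrite (bigD1 i)//= eqxx mulr1 big1 ?addr0//.
  by move=> j /negPf; rewrite eq_sym => ->; rewrite mulr0.
have deltaE (g : I * I -> R) q : \sum_r g r * (q == r)%:R = g q.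
  rewrite (bigD1 q)//= eqxx mulr1 big1 ?addr0// => r /negPf.
  by rewrite eq_sym => ->; rewrite mulr0.
transitivity (\sum_q (e * (a q * b q) + f * ((a q * (q.1 == q.2)%:R)
    * \sum_i b (i, i)) + h * (a q * b q * (q.1 == q.2)%:R))).
  apply: eq_bigr => q _; rewrite -[in RHS](diagE b) -(deltaE (fun r => b r) q).
  rewrite !(mulr_sumr, mulr_suml) -!big_split /=; apply: eq_bigr => r _.
  rewrite -!mulnb !natrM; ring.
by rewrite !big_split /= -!mulr_sumr -mulr_suml !diagE.
Qed.

Section unitary_invariance.
Context {R : realType} (p : nat) d (T : measurableType d) (P : probability T R).
Variable s : T -> 'M[R[i]]_p.
Hypothesis s_L2 : forall i j, square_integrable P (fun w => s w i j).
(** Invariance in law under unitary conjugation, phrased through test functions [h] so that means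
    and covariances are both instances. *)
Hypothesis s_unitary : forall U : 'M[R[i]]_p, U *m U^t* = 1%:M ->
  forall h : 'M[R[i]]_p -> R[i], measurable_fun setT h ->
  cexp P (fun w => h (s w)) = cexp P (fun w => h (U *m s w *m U^t*)).

Local Notation mean i j := (cexp P (fun w => s w i j)).
Local Notation tensor i j k l :=
  (ccov P (fun w => s w i j) (fun w => s w k l)).

Lemma unitary_mean (U : 'M[R[i]]_p) i j : U *m U^t* = 1%:M ->
  mean i j = cexp P (fun w => (U *m s w *m U^t*) i j).
Proof.
move=> UU; apply: (s_unitary UU (h := fun M => M i j)).
exact: measurable_mxcoef.
Qed.

Lemma unitary_ccov (U : 'M[R[i]]_p) i j k l : U *m U^t* = 1%:M ->
  ccov P (fun w => s w i j) (fun w => s w k l) =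
  ccov P (fun w => (U *m s w *m U^t*) i j) (fun w => (U *m s w *m U^t*) k l).
Proof.
move=> UU; rewrite /ccov -!unitary_mean//.
apply: (s_unitary UU (h := fun M => (M i j - mean i j) *
  Num.conj (M k l - mean k l))).
have mB a b : measurable_fun setT (fun M : 'M[R[i]]_p => M a b - mean a b).
  apply: measurable_fun_cadd; last exact: measurable_cst.
  exact: measurable_mxcoef.
by apply: measurable_fun_cmul => //; exact: measurable_fun_conj.
Qed.

(* Multiplying one coordinate by -1 would not separate [T_ij,ji] from
   [T_ij,ij], whence the imaginary unit. *)
Let phase (k a : 'I_p) : R[i] := if a == k then 'i%C else 1.

Let phase_unitary k : diag_mx (\row_a phase k a) *m (diag_mx (\row_a phase k a))^t*
  = 1%:M.
Proof.
rewrite mul_diag_mx; apply/matrixP => a b; rewrite !mxE eq_sym.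
case: eqP => [->|_]; rewrite ?mulr0n ?conjC0 ?mulr0// !mulr1n.
rewrite /phase; case: ifP => _; last by rewrite conjC1 mulr1.
by apply/eqP; rewrite eq_complex /=; apply/andP; split; apply/eqP; ring.
Qed.

Let phaseE k i j w :
  (diag_mx (\row_a phase k a) *m s w *m (diag_mx (\row_a phase k a))^t*) i j =
  (phase k i * Num.conj (phase k j)) * s w i j.
Proof.
rewrite tr_diag_mx map_diag_mx mul_diag_mx mul_mx_diag !mxE.
by rewrite mulrAC.
Qed.

Let i_neq1 : 'i%C != 1 :> R[i].
Proof. by rewrite eq_complex /= negb_and eq_sym oner_eq0. Qed.

Let ii_neq1 : 'i%C * 'i%C != 1 :> R[i].
Proof.
rewrite eq_complex /= negb_and; apply/orP; left.
by rewrite mul0r sub0r mulr1 -subr_eq0 -opprD oppr_eq0 (pnatr_eq0 _ 2).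
Qed.

Let fix0 (z t : R[i]) : z != 1 -> t = z * t -> t = 0.
Proof.
move=> z1 tE; apply/eqP; have := subrr t; rewrite {1}tE -{2}[t]mul1r -mulrBl.
by move/eqP; rewrite mulf_eq0 subr_eq0 (negPf z1).
Qed.

Lemma mean_offdiag i j : i != j -> mean i j = 0.
Proof.
move=> ij; apply: (fix0 i_neq1).
rewrite [LHS](unitary_mean _ _ (phase_unitary i)).
under eq_fun do rewrite phaseE.
rewrite cexpZ; last exact: square_integrableC.
by rewrite /phase eqxx eq_sym (negPf ij) conjC1 mulr1.
Qed.

Let perm_unitary (t : 'S_p) : perm_mx t *m (perm_mx t)^t* = 1%:M :> 'M[R[i]]_p.
Proof. by rewrite tr_perm_mx map_perm_mx -perm_mxM mulgV perm_mx1. Qed.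

Let permE (t : 'S_p) i j w :
  (perm_mx t *m s w *m (perm_mx t)^t*) i j = s w (t i) (t j).
Proof. by rewrite tr_perm_mx map_perm_mx -col_permE -row_permE !mxE. Qed.

Lemma mean_diag i j : mean i i = mean j j.
Proof.
rewrite (unitary_mean _ _ (perm_unitary (tperm i j))).
by under eq_fun do rewrite permE tpermL.
Qed.

Lemma tensor_perm (t : 'S_p) i j k l :
  tensor i j k l = tensor (t i) (t j) (t k) (t l).
Proof.
rewrite (unitary_ccov _ _ _ _ (perm_unitary t)) /=.
by congr ccov; apply/funext => w; rewrite permE.
Qed.

Lemma tensor_phase m i j k l : tensor i j k l =
  (phase m i * Num.conj (phase m j)) * (Num.conj (phase m k) * phase m l)
  * tensor i j k l.
Proof.
rewrite [LHS](unitary_ccov _ _ _ _ (phase_unitary m)) /=.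
under eq_fun do rewrite phaseE.
under [X in ccov _ _ X]eq_fun do rewrite phaseE.
by rewrite ccovZ// rmorphM/= conjCK.
Qed.

(** In every pattern of coincidences some index carries an unbalanced phase: rotating that
    coordinate multiplies the entry by the imaginary unit, its conjugate or its square, none of
    which is 1. The square occurs when [l = i] differs from [j] and [k], as in T_ij,ji. *)
Lemma tensor_eq0 i j k l : (i, j) != (k, l) -> ~~ ((i == j) && (k == l)) ->
  tensor i j k l = 0.
Proof.
have iiJ : 'i%C * Num.conj 'i%C = 1 :> R[i].
  by apply/eqP; rewrite eq_complex /=; apply/andP; split; apply/eqP; ring.
have iJ : Num.conj 'i%C != 1 :> R[i].
  by apply/eqP => /(congr1 Num.conj); rewrite conjCK conjC1; exact/eqP.
have phase1 m : phase m m = 'i%C by rewrite /phase eqxx.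
have phaseN m a : a != m -> phase m a = 1 by rewrite /phase => /negPf ->.
rewrite xpair_eqE; have [<-{j}|ij] /= := eqVneq i j.
  have [<-{k}|ik] /= := eqVneq i k => il kl.
    apply: (fix0 iJ); rewrite {1}(tensor_phase i) phase1.
    rewrite [phase i l]phaseN 1?eq_sym//.
    by rewrite iiJ mulr1 mul1r.
  apply: (fix0 iJ); rewrite {1}(tensor_phase k) phase1 [phase k i]phaseN//.
  by rewrite [phase k l]phaseN 1?eq_sym// conjC1 !mul1r mulr1.
have [<-{k}|ik] /= := eqVneq i k => jl _.
  apply: (fix0 iJ); rewrite {1}(tensor_phase j) phase1 [phase j i]phaseN//.
  by rewrite [phase j l]phaseN 1?eq_sym// conjC1 !mul1r !mulr1.
have [li|il] := eqVneq i l.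
  rewrite -{}li in jl *; apply: (fix0 ii_neq1).
  rewrite {1}(tensor_phase i) phase1 [phase i j]phaseN 1?eq_sym//.
  by rewrite [phase i k]phaseN 1?eq_sym// conjC1 mulr1 mul1r.
apply: (fix0 i_neq1); rewrite {1}(tensor_phase i) phase1.
rewrite [phase i j]phaseN 1?eq_sym// [phase i k]phaseN 1?eq_sym//.
by rewrite [phase i l]phaseN 1?eq_sym// conjC1 !mulr1.
Qed.

Section isotropic.
Variables (i1 i2 : 'I_p).
Hypothesis i12 : i1 != i2.

Local Notation t1 := (tensor i1 i2 i1 i2).
Local Notation t2 := (tensor i1 i1 i2 i2).
Local Notation t3 := (tensor i1 i1 i1 i1).

(** The surviving entries fall into three orbits under permutations, represented by [t1], [t2] and
    [t3]. On fully equal indices all three indicators are 1, hence the correction [t3 - t1 - t2]. *)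
Let tensor_form3 q r : tensor q.1 q.2 r.1 r.2 = t1 * (q == r)%:R
  + t2 * ((q.1 == q.2) && (r.1 == r.2))%:R
  + (t3 - t1 - t2) * ((q == r) && (q.1 == q.2))%:R.
Proof.
case: q r => [i j] [k l].
have [/eqP[<- <-]|qr] /= := boolP ((i, j) == (k, l)).
  have [<-|ij] /= := eqVneq i j.
    rewrite (tensor_perm (tperm i i1)) tpermL; ring.
  rewrite mulr1 !mulr0 !addr0; have [t [<- <-]] := ord_pair_transitive i12 ij.
  by rewrite -tensor_perm.
rewrite !mulr0 add0r addr0.
have [/andP[/eqP ij /eqP kl]|ijkl] := boolP ((i == j) && (k == l)).
  rewrite -{}ij -{}kl in qr *.
  have ik : i != k by apply: contraNneq qr => ->.
  have [t [<- <-]] := ord_pair_transitive i12 ik.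
  by rewrite mulr1 -tensor_perm.
by rewrite mulr0 tensor_eq0.
Qed.

(* The reflection in [v^perp] has the rational row [i1] made of 3/5 and 4/5. *)
Let v : 'cV[R[i]]_p := delta_mx i1 0 - 2 *: delta_mx i2 0.
Let householder : 'M[R[i]]_p := 1%:M - (2 / 5) *: (v *m v^T).

Let householder_unitary : householder *m householder^t* = 1%:M.
Proof.
have vJ : map_mx Num.conj v = v.
  by rewrite /v map_mxB map_mxZ !map_delta_mx /= (conjC_nat _ 2).
have vT : v^T = delta_mx 0 i1 - 2 *: delta_mx 0 i2.
  by rewrite /v linearB linearZ /= !trmx_delta.
have vv : v^T *m v = 5%:M.
  rewrite vT /v mulmxBl !mulmxBr -!scalemxAl -!scalemxAr.
  rewrite !mul_delta_mx_cond (negPf i12) eq_sym (negPf i12) !eqxx !mulr0n !mulr1n.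
  apply/matrixP => a b; rewrite !ord1 !mxE !eqxx; ring.
have HJ : householder^t* = householder.
  have -> : householder^T = householder.
    by rewrite /householder linearB linearZ /= trmx_mul trmxK trmx1.
  rewrite /householder map_mxB map_mxZ map_mxM map_mx1 -map_trmx vJ.
  by rewrite rmorphM/= fmorphV /= (conjC_nat _ 2) (conjC_nat _ 5).
have WW : (v *m v^T) *m (v *m v^T) = 5 *: (v *m v^T).
  by rewrite mulmxA -(mulmxA v) vv mul_mx_scalar -scalemxAl.
rewrite HJ /householder; move: (v *m v^T) WW => W WW.
rewrite mulmxBl mul1mx mulmxBr mulmx1 -scalemxAl -scalemxAr WW.
by apply/matrixP => a b; rewrite !mxE; field.
Qed.

Let householder_row a : householder i1 a =
  3 / 5 * (a == i1)%:R + 4 / 5 * (a == i2)%:R.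
Proof.
rewrite /householder !mxE big_ord1 !mxE !eqxx (negPf i12) (eq_sym i1).
by case: (a == i1); case: (a == i2); rewrite ?mulr1n ?mulr0n; field.
Qed.

(** Conjugation by the reflection expresses [t3] through the entries [u] of its row [i1]. Since the
    squares of [u] sum to 1, this reads [t3 = t1 + t2 + (t3 - t1 - t2) * s] with [s] the sum of
    fourth powers; as [s] is not 1, the remainder vanishes. *)
Lemma tensor_form q r : tensor q.1 q.2 r.1 r.2 = t1 * (q == r)%:R
  + t2 * ((q.1 == q.2) && (r.1 == r.2))%:R.
Proof.
rewrite tensor_form3.
suff -> : t3 = t1 + t2 by rewrite -[_ - t1 - t2]addrA -opprD subrr mul0r addr0.
pose u := householder i1.
have uJ a : Num.conj (u a) = u a.
  rewrite /u householder_row rmorphD !rmorphM/= !fmorphV /=.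
  by rewrite !conjC_nat.
have t3E : t3 =
    \sum_q \sum_r (u q.1 * u q.2) * (u r.1 * u r.2) * tensor q.1 q.2 r.1 r.2.
  rewrite [LHS](unitary_ccov _ _ _ _ householder_unitary) /=.
  under eq_fun do rewrite sandwichE.
  rewrite ccov_sum//; apply: eq_bigr => q' _; apply: eq_bigr => r' _.
  by rewrite -/u !rmorphM /= !uJ.
have u2 : \sum_a u a * u a = 1.
  have /matrixP/(_ i1 i1) := householder_unitary.
  rewrite mxE [1%:M _ _]mxE eqxx mulr1n => <-.
  apply: eq_bigr => a _.
  by rewrite [householder^t* _ _]mxE [householder^T _ _]mxE -/u uJ.
(* The value is (3/5)^4 + (4/5)^4. *)
have u4 : \sum_a (u a * u a) * (u a * u a) = 337 / 625.
  rewrite (bigD1 i1)//= (bigD1 i2) 1?eq_sym//= big1 ?addr0.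
    rewrite /u !householder_row !eqxx (negPf i12) [i2 == i1]eq_sym (negPf i12).
    by rewrite ?mulr1n ?mulr0n; field.
  move=> a /andP[ai1 ai2].
  by rewrite /u householder_row (negPf ai1) (negPf ai2) !mulr0n !mulr0 addr0 !mulr0.
move: t3E; under eq_bigr do under eq_bigr do rewrite tensor_form3.
rewrite isotropic_contraction u2 u4.
rewrite -(pair_big xpredT xpredT (fun a b => (u a * u b) * (u a * u b))) /=.
have -> : \sum_a \sum_b (u a * u b) * (u a * u b) = 1.
  under eq_bigr do under eq_bigr do rewrite mulrACA.
  by rewrite -big_distrlr /= u2 mulr1.
move=> /eqP; rewrite -subr_eq0 => /eqP t3E.
(* The coefficient is 1 - 337/625. *)
have : (288 / 625) * (t3 - t1 - t2) = 0 by rewrite -t3E; field.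
move/eqP; rewrite mulf_eq0 => /orP[|].
  by rewrite mulf_eq0 invr_eq0 !pnatr_eq0.
by rewrite -addrA -opprD subr_eq0 => /eqP.
Qed.

End isotropic.

End unitary_invariance.

(** * Affine equivariant statistics *)

Lemma hermsymmxE (C : numClosedFieldType) p (A : 'M[C]_p) :
  A \is hermsymmx -> A^t* = A.
Proof. by move/is_hermitianmxP => AE; rewrite [RHS]AE expr0 scale1r. Qed.

Lemma posdefmx_unit (R : realType) p (A : 'M[R[i]]_p) :
  posdefmx A -> A \in unitmx.
Proof.
move=> [_ A0]; rewrite -row_free_unit -kermx_eq0; apply/negPn/negP.
move=> /rowV0Pn[v /sub_kermxP vA v0].
have vt0 : v^t* != 0.
  by apply: contra_neq v0 => vt0; rewrite -(trmxCK v) vt0 trmx0 map_mx0.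
by have := A0 _ vt0; rewrite trmxCK vA mul0mx mxE ltxx.
Qed.

Section equivariance.
Context {R : realType} (n p : nat).
Local Notation V := 'cV[R[i]]_p.

Lemma ccov_law d (T : measurableType d) (P : probability T R)
    d' (T' : measurableType d') (P' : probability T' R)
    e (U : measurableType e) (X : T -> U) (Y : T' -> U) :
  measurable_fun setT X -> measurable_fun setT Y ->
  (forall A, measurable A -> P (X @^-1` A) = P' (Y @^-1` A)) ->
  forall f h : U -> R[i], measurable_fun setT f -> measurable_fun setT h ->
  ccov P (fun w => f (X w)) (fun w => h (X w)) =
  ccov P' (fun w => f (Y w)) (fun w => h (Y w)).
Proof.
move=> mX mY XY f h mf mh; rewrite /ccov !(cexp_law mX mY XY)//.
apply: (cexp_law mX mY XY (f := fun u => (f u - cexp P' (fun w => f (Y w))) *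
  Num.conj (h u - cexp P' (fun w => h (Y w))))).
by apply: measurable_fun_cmul; [|apply: measurable_fun_conj];
  apply: measurable_fun_cadd => //; exact: measurable_cst.
Qed.

Variables (g : R -> R) (Shat : 'M[R[i]]_(n, p) -> 'M[R[i]]_p).
Hypotheses (gg : density_generator g) (Shat_meas : measurable_fun setT Shat)
  (Shat_equiv : affine_equivariant Shat).

Lemma ces_sample_law d (T : measurableType d) (P : probability T R)
    (x : 'I_n -> {RV P >-> V}) mu Sigma d0 (T0 : measurableType d0)
    (P0 : probability T0 R) (x0 : 'I_n -> {RV P0 >-> V}) (B : 'M[R[i]]_p) :
  ces_sample x mu Sigma g -> ces_sample x0 0 1%:M g ->
  B \in unitmx -> B *m B^t* = Sigma ->
  forall A, measurable A ->
    P (data_mx (fun k => x k) @^-1` A) =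
    P0 (data_mx (fun k w => B *m x0 k w + mu) @^-1` A).
Proof.
move=> [xI xE] [x0I x0E] Bu BE; apply: sample_law => //.
- by move=> k; apply: (measurableT_comp (measurable_fun_affine B mu)).
- exact: (mutually_independent_comp (measurable_fun_affine B mu) x0I).
- by move=> k A mA; exact: (ces_affine gg (xE k) (x0E k)).
Qed.

(** Transforming each observation by [B] and [mu] turns the data matrix X into X B^T + 1 mu^T, the
    form in which equivariance is stated. *)
Lemma Shat_data_affine (T : Type) (x : 'I_n -> T -> V) (B : 'M[R[i]]_p) mu w :
  Shat (data_mx (fun k w => B *m x k w + mu) w) =
  B *m Shat (data_mx x w) *m B^t*.
Proof.
rewrite -(Shat_equiv _ B mu); congr Shat; apply/matrixP => k j.
rewrite !mxE big_ord1 !mxE mul1r; congr (_ + _).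
by apply: eq_bigr => a _; rewrite !mxE mulrC.
Qed.

Section sample.
Context d (T : measurableType d) (P : probability T R).
Variables (x : 'I_n -> {RV P >-> V}) (mu : V) (Sigma : 'M[R[i]]_p).
Context d0 (T0 : measurableType d0) (P0 : probability T0 R).
Variable x0 : 'I_n -> {RV P0 >-> V}.
Variable B : 'M[R[i]]_p.
Hypotheses (x_sample : ces_sample x mu Sigma g)
  (x0_sample : ces_sample x0 0 1%:M g)
  (B_unit : B \in unitmx) (BE : B *m B^t* = Sigma).

Let S w := Shat (data_mx (fun k => x k) w).
Let S0 w := Shat (data_mx (fun k => x0 k) w).

Let X_meas : measurable_fun setT (data_mx (fun k => x k)).
Proof. exact: measurable_data_mx. Qed.

Let Y_meas : measurable_fun setT (data_mx (fun k w => B *m x0 k w + mu)).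
Proof.
apply: measurable_data_mx => k.
by apply: (measurableT_comp (measurable_fun_affine B mu)).
Qed.

Let law := ces_sample_law x_sample x0_sample B_unit BE.

Lemma cexp_Shat (h : 'M[R[i]]_p -> R[i]) : measurable_fun setT h ->
  cexp P (fun w => h (S w)) = cexp P0 (fun w => h (B *m S0 w *m B^t*)).
Proof.
move=> mh; rewrite [LHS](cexp_law X_meas Y_meas law (f := h \o Shat)).
  by congr cexp; apply/funext => w /=; rewrite Shat_data_affine.
exact: measurableT_comp.
Qed.

Lemma ccov_Shat i j k l :
  ccov P (fun w => S w i j) (fun w => S w k l) =
  ccov P0 (fun w => (B *m S0 w *m B^t*) i j) (fun w => (B *m S0 w *m B^t*) k l).
Proof.
rewrite [LHS](ccov_law X_meas Y_meas law
  (f := fun M => Shat M i j) (h := fun M => Shat M k l));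
  try exact: measurable_fun_mxcoef.
by congr ccov; apply/funext => w; rewrite Shat_data_affine.
Qed.

(** The moment hypothesis concerns the sample with covariance [Sigma]. Conjugating its statistic by
    [invmx B] gives the law of [S0], whose entries thus have the law of finite linear combinations
    of square integrable variables. *)
Lemma square_integrable_Shat0 :
  (forall i j, square_integrable P (fun w => S w i j)) ->
  forall i j, square_integrable P0 (fun w => S0 w i j).
Proof.
move=> SL2 i j.
pose h M := (invmx B *m Shat M *m (invmx B)^t*) i j.
have mh : measurable_fun setT h.
  apply: measurable_fun_mxcoef; apply: measurable_fun_mulmx.
    by apply: measurable_fun_mulmx => //; exact: measurable_cst.
  exact: measurable_cst.
have := square_integrable_law X_meas Y_meas law mh.
have -> : (fun w => h (data_mx (fun k w => B *m x0 k w + mu) w)) =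
    (fun w => S0 w i j).
  apply/funext => w; rewrite /h Shat_data_affine -/(S0 w) !mulmxA mulVmx//.
  by rewrite mul1mx -mulmxA -adjmxM mulVmx// trmx1 map_mx1 mulmx1.
apply; rewrite /h; under eq_fun do rewrite sandwichE.
by apply: square_integrable_sum => q; exact: square_integrableZ.
Qed.

End sample.

End equivariance.

(** * Entries of the variance and pseudo-variance of a vectorized matrix *)

Section vectorized_moments.
Context {R : realType} (p : nat) d (T : measurableType d) (P : probability T R).
Variable S : T -> 'M[R[i]]_p.

Let vec_centered w m :
  (vec (S w) - mxexp P (fun w' => vec (S w'))) m 0 =
  S w (mxtens_unindex m).2 (mxtens_unindex m).1 -
  cexp P (fun w' => S w' (mxtens_unindex m).2 (mxtens_unindex m).1).
Proof. by rewrite !mxE; under [in LHS]eq_fun do rewrite mxE. Qed.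

Lemma var_vecE k l : var P (fun w => vec (S w)) k l =
  ccov P (fun w => S w (mxtens_unindex k).2 (mxtens_unindex k).1)
         (fun w => S w (mxtens_unindex l).2 (mxtens_unindex l).1).
Proof.
rewrite /var /cov mxE; congr cexp; apply/funext => w.
have adjE (z : 'cV[R[i]]_(p * p)) m : z^t* 0 m = Num.conj (z m 0) by rewrite !mxE.
by rewrite mxE big_ord1 adjE !vec_centered.
Qed.

(** For a Hermitian matrix, conjugating an entry swaps its indices, so a pseudo-covariance is a
    covariance with the second index pair reversed. *)
Lemma pvar_vecE k l : (forall w, (S w)^t* = S w) ->
  (forall i j, square_integrable P (fun w => S w i j)) ->
  pvar P (fun w => vec (S w)) k l =
  ccov P (fun w => S w (mxtens_unindex k).2 (mxtens_unindex k).1)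
         (fun w => S w (mxtens_unindex l).1 (mxtens_unindex l).2).
Proof.
move=> SH SL2.
have SC i j w : Num.conj (S w i j) = S w j i by rewrite -[in RHS]SH !mxE.
rewrite /pvar /pcov mxE; congr cexp; apply/funext => w.
have trE (z : 'cV[R[i]]_(p * p)) m : z^T 0 m = z m 0 by rewrite mxE.
rewrite mxE big_ord1 trE !vec_centered rmorphB/= SC.
rewrite -cexp_conj; last exact: square_integrableC.
by under [X in _ = _ * (_ - cexp P X)]eq_fun do rewrite SC.
Qed.

End vectorized_moments.

(** Column [l] of the commutation matrix is the basis vector at the index pair of [l] reversed, so
    right multiplication permutes columns. *)
Lemma mul_commutation_mx (R : realType) p (A : 'M[R[i]]_(p * p)) k l :
  (A *m commutation_mx p) k l =
  A k (mxtens_index ((mxtens_unindex l).2, (mxtens_unindex l).1)).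
Proof.
have KE m : commutation_mx p m l =
    (m == mxtens_index ((mxtens_unindex l).2, (mxtens_unindex l).1))%:R :> R[i].
  rewrite /commutation_mx summxE.
  under eq_bigr do rewrite summxE.
  rewrite -{1}(mxtens_unindexK m) -{1}(mxtens_unindexK l).
  case: (mxtens_unindex m) (mxtens_unindexK m) => a b mE.
  case: (mxtens_unindex l) => c e /=.
  under eq_bigr do under eq_bigr do rewrite tensmxE !mxE.
  rewrite (bigD1 a)//= (bigD1 c)//= !eqxx /= big1 ?addr0; last first.
    by move=> j /negPf jc; rewrite [c == j]eq_sym jc ?andbF mulr0n mul0r.
  rewrite big1 ?addr0 => [|i /negPf ia]; last first.
    by apply: big1 => j _; rewrite [a == i]eq_sym ia mulr0n mul0r.
  rewrite mul1r -mE (inj_eq (can_inj (@mxtens_indexK _ _))) xpair_eqE.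
  by rewrite [e == a]eq_sym andbC.
rewrite mxE (bigD1 (mxtens_index ((mxtens_unindex l).2, (mxtens_unindex l).1)))//=.
by rewrite KE eqxx mulr1 big1 ?addr0// => m /negPf mN; rewrite KE mN mulr0.
Qed.

Theorem theorem2 (R : realType) (n p : nat) (n_gt0 : (0 < n)%N)
  (p_gt1 : (1 < p)%N)
  (g : R -> R) (g_gen : density_generator g)
  (mu : 'cV[R[i]]_p) (Sigma : 'M[R[i]]_p)
  (Shat : 'M[R[i]]_(n, p) -> 'M[R[i]]_p)
  (Shat_meas : measurable_fun [set: 'M[R[i]]_(n, p)] Shat)
  (Shat_herm : forall X, Shat X \is hermsymmx)
  (Shat_equiv : affine_equivariant Shat)
  (d : measure_display) (T : measurableType d) (P : probability T R)
  (x : 'I_n -> {RV P >-> 'cV[R[i]]_p})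
  (x_sample : ces_sample x mu Sigma g)
  (Shat_moment2 : forall i j,
     finite_moment P 2 (fun w => Shat (data_mx (fun k => x k) w) i j))
  (d0 : measure_display) (T0 : measurableType d0) (P0 : probability T0 R)
  (x0 : 'I_n -> {RV P0 >-> 'cV[R[i]]_p})
  (x0_sample : ces_sample x0 0 1%:M g) :
  let i1 : 'I_p := Ordinal (ltnW p_gt1) in
  let i2 : 'I_p := Ordinal p_gt1 in
  let S := fun w : T => Shat (data_mx (fun k => x k) w) in
  let S0 := fun w : T0 => Shat (data_mx (fun k => x0 k) w) in
  let sigma := cexp P0 (fun w => S0 w i1 i1) in
  let tau1 := cvar P0 (fun w => S0 w i1 i2) in
  let tau2 := ccov P0 (fun w => S0 w i1 i1) (fun w => S0 w i2 i2) in
  [/\ mxexp P S = sigma *: Sigma,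
      var P (fun w => vec (S w)) =
        tau1 *: (map_mx Num.conj Sigma *t Sigma)
        + tau2 *: (vec Sigma *m (vec Sigma)^t*),
      pvar P (fun w => vec (S w)) =
        tau1 *: ((map_mx Num.conj Sigma *t Sigma) *m commutation_mx p)
        + tau2 *: (vec Sigma *m (vec Sigma)^T) &
      - (tau1 / p%:R) <= tau2].
Proof.
move=> i1 i2 S S0 sigma tau1 tau2.
have i12 : i1 != i2 by [].
have [_ xE] := x_sample.
(* The representation of one observation supplies the Hermitian square root [B] of [Sigma]; being
   Hermitian, it factors [Sigma] as B B^H. *)
have [_ _ _ _ [B [Bpos BB] _] _] := xE (Ordinal n_gt0).
have Bu := posdefmx_unit Bpos.
have BE : B *m B^t* = Sigma by rewrite (hermsymmxE Bpos.1).
have SL2 i j : square_integrable P (fun w => S w i j).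
  split=> //; apply: measurable_fun_mxcoef; apply: (measurableT_comp Shat_meas).
  exact: measurable_data_mx.
have S0L2 := square_integrable_Shat0 g_gen Shat_meas Shat_equiv
  x_sample x0_sample Bu BE SL2.
(* Unitary invariance is the transfer of laws from the spherical sample to itself, with [U] in place
   of [B]. *)
have S0U (U : 'M[R[i]]_p) : U *m U^t* = 1%:M ->
    forall h : 'M[R[i]]_p -> R[i], measurable_fun setT h ->
    cexp P0 (fun w => h (S0 w)) = cexp P0 (fun w => h (U *m S0 w *m U^t*)).
  move=> UU h mh; have [Uu _] := mulmx1_unit UU.
  exact: (cexp_Shat g_gen Shat_meas Shat_equiv x0_sample x0_sample Uu UU mh).
have meanE a b : cexp P0 (fun w => S0 w a b) = sigma * (a == b)%:R.
  have [<-|ab] := eqVneq a b; last by rewrite mulr0 (mean_offdiag S0L2 S0U ab).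
  by rewrite mulr1; exact: (mean_diag S0U).
have tensorE q r : ccov P0 (fun w => S0 w q.1 q.2) (fun w => S0 w r.1 r.2) =
    tau1 * (q == r)%:R + tau2 * ((q.1 == q.2) && (r.1 == r.2))%:R.
  exact: (tensor_form S0L2 S0U i12).
have contract (a b : 'I_p * 'I_p -> R[i]) :
    ccov P0 (fun w => \sum_q a q * S0 w q.1 q.2)
            (fun w => \sum_r b r * S0 w r.1 r.2) =
    tau1 * (\sum_q a q * Num.conj (b q)) +
    tau2 * ((\sum_i a (i, i)) * (\sum_i Num.conj (b (i, i)))).
  rewrite ccov_sum; last by move=> q; exact: S0L2.
  rewrite -[RHS]addr0.
  (* A zero anisotropic term is inserted to match [isotropic_contraction] with [h = 0]. *)
  rewrite -[X in _ = _ + X](mul0r (\sum_i a (i, i) * Num.conj (b (i, i)))).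
  rewrite -(isotropic_contraction tau1 tau2 0 a (fun q => Num.conj (b q))).
  by apply: eq_bigr => q _; apply: eq_bigr => r _; rewrite tensorE mul0r addr0.
have SigmaE i j : Sigma i j = \sum_a B i a * Num.conj (B j a).
  by rewrite -BE mxE; apply: eq_bigr => a _; rewrite !mxE.
have SigmaJ i j : Num.conj (Sigma i j) = Sigma j i.
  rewrite !SigmaE rmorph_sum; apply: eq_bigr => a _.
  by rewrite rmorphM /= conjCK mulrC.
have meanS i j : cexp P (fun w => S w i j) = sigma * Sigma i j.
  rewrite [LHS](cexp_Shat g_gen Shat_meas Shat_equiv x_sample x0_sample Bu BE
    (h := fun M => M i j)); last exact: measurable_mxcoef.
  rewrite -/S0; under eq_fun do rewrite sandwichE.
  rewrite cexp_sum; last first.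
    by move=> q; apply: integrableCZ; exact: square_integrableC (S0L2 _ _).
  rewrite SigmaE mulr_sumr -(pair_big xpredT xpredT (fun a b =>
    cexp P0 (fun w => B i a * Num.conj (B j b) * S0 w a b))) /=.
  apply: eq_bigr => a _; rewrite (bigD1 a)//= big1 ?addr0.
    rewrite cexpZ; last exact: square_integrableC (S0L2 _ _).
    by rewrite meanE eqxx mulr1 mulrC.
  move=> b ba; rewrite cexpZ; last exact: square_integrableC (S0L2 _ _).
  by rewrite meanE eq_sym (negPf ba) !mulr0.
(* The coefficients in [B] factor: pairing both entries contracts rows [i], [k] and rows [l], [j]
   into entries of [Sigma], and the traces contract [i], [j] and [l], [k]. *)
have covS i j k l : ccov P (fun w => S w i j) (fun w => S w k l) =
    tau1 * (Sigma i k * Sigma l j) + tau2 * (Sigma i j * Sigma l k).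
  rewrite (ccov_Shat g_gen Shat_meas Shat_equiv x_sample x0_sample Bu BE) -/S0.
  under eq_fun do rewrite sandwichE.
  under [X in ccov _ _ X]eq_fun do rewrite sandwichE.
  rewrite contract /= -(SigmaJ k l) !SigmaE rmorph_sum /=.
  congr (_ * _ + _ * (_ * _)).
  rewrite big_distrlr pair_bigA /=; apply: eq_bigr => q _.
  by rewrite rmorphM /= conjCK; ring.
split.
- by apply/matrixP => i j; rewrite !mxE meanS.
(* In column stacking the column index selects the first Kronecker factor; reversing the indices of
   [Sigma] there yields its conjugate. *)
- apply/matrixP => k l; rewrite var_vecE covS [RHS]mxE; congr (_ + _).
    rewrite [RHS]mxE /tensmx [in RHS]mxE [(_ ^ _)%sesqui _ _]mxE SigmaJ.
    by rewrite [Sigma _ _ * _]mulrC.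
  by rewrite [RHS]mxE mxE big_ord1 !mxE SigmaJ.
- apply/matrixP => k l; rewrite pvar_vecE//; last first.
    by move=> w; exact: hermsymmxE (Shat_herm _).
  (* The reversed second index pair is exactly the column permutation made by the commutation
     matrix. *)
  rewrite covS [RHS]mxE; congr (_ + _).
    rewrite [RHS]mxE mul_commutation_mx /tensmx [in RHS]mxE mxtens_indexK /=.
    by rewrite [(_ ^ _)%sesqui _ _]mxE SigmaJ [Sigma _ _ * _]mulrC.
  by rewrite [RHS]mxE mxE big_ord1 !mxE.
- have p0 : 0 < p%:R :> R[i] by rewrite ltr0n ltnW.
  (* With these coefficients the linear combination is the trace of [S0], whose variance is
     nonnegative. *)
  pose tr (q : 'I_p * 'I_p) : R[i] := (q.1 == q.2)%:R.
  have : 0 <= ccov P0 (fun w => \sum_q tr q * S0 w q.1 q.2)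
                      (fun w => \sum_q tr q * S0 w q.1 q.2).
    by apply: cexp_ge0 => w; exact: mul_conjC_ge0.
  have trJ q : Num.conj (tr q) = tr q by rewrite conjC_nat.
  rewrite contract; under eq_bigr do rewrite trJ.
  have -> : \sum_q tr q * tr q = p%:R.
    rewrite -(pair_big xpredT xpredT (fun a b => tr (a, b) * tr (a, b))) /=.
    rewrite -[p in RHS]card_ord -sum1_card natr_sum; apply: eq_bigr => a _.
    rewrite (bigD1 a)//= big1 ?addr0 /tr /= ?eqxx ?mulr1//.
    by move=> b /negPf; rewrite eq_sym => ->; rewrite mulr0.
  have trd : \sum_i tr (i, i) = p%:R.
    rewrite -[p in RHS]card_ord -sum1_card natr_sum; apply: eq_bigr => a _.
    by rewrite /tr eqxx.
  under [X in _ * (_ * X)]eq_bigr do rewrite trJ.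
  (* The variance factors as [(tau1 + tau2 * p) * p], and the positive factor [p] is removed. *)
  rewrite trd mulrA -mulrDl pmulr_lge0// => t0.
  by rewrite -subr_ge0 opprK -(pmulr_rge0 _ p0) mulrDr mulrCA mulfV ?gt_eqF// mulr1
    addrC mulrC.
Qed.
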